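(* Let $F$ be a field, let $A$ be a finite-dimensional central simple $F$-algebra containing a (finite) Galois field extension $K/F$ with abelian Galois group $G=\mathrm{Gal}[K/F]$, let $\Gamma$ be a totally ordered abelian (additive) group and let $\varepsilon:\Gamma\to G$ be a surjective homomorphism. Let $C_A(K)$ be the centralizer of $K$ in $A$ and let $\mathcal{D}=C_A(K)((\Gamma))$ be the associated Mal'cev-Neumann ring. If $C_A(K)$ is a division algebra and $L$ is a maximal subfield of $\mathcal{D}$, then $\overline{L}K$ is a maximal subfield of $C_A(K)$. Moreover, if $L/F((\ker\varepsilon))$ is a Galois extension and $\mathrm{char}\,F$ does not divide $[\overline{L}:F]$, then $\overline{L}K$ is Galois over $F$.
   Context: Construction of the Mal'cev-Neumann ring $C_A(K)((\Gamma))$: by the Skolem-Noether theorem, for each $\sigma\in G$ choose $u_\sigma\in A^\times$ with $x^\sigma=u_\sigma^{-1}xu_\sigma$ for all $x\in K$, with $u_{\mathrm{Id}}=1$. The elements of $C_A(K)((\Gamma))$ are formal series $\sum_{\gamma\in\Gamma}a_\gamma r_\gamma$ in indeterminates $a_\gamma$, with $r_\gamma\in C_A(K)$, whose support $\mathrm{supp}\big(\sum_\gamma a_\gamma r_\gamma\big)=\{\gamma\in\Gamma\mid r_\gamma\ne 0\}$ is well-ordered. Addition is componentwise; multiplication is determined by the rules $r a_\gamma=a_\gamma\,(u_{\varepsilon(\gamma)}^{-1}ru_{\varepsilon(\gamma)})$ for $r\in C_A(K)$, $\gamma\in\Gamma$, and $a_\gamma a_\delta=a_{\gamma+\delta}\,u_{\varepsilon(\gamma)\varepsilon(\delta)}^{-1}u_{\varepsilon(\gamma)}u_{\varepsilon(\delta)}$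 for $\gamma,\delta\in\Gamma$. This is a well-defined associative ring. For $L\subseteq C_A(K)$ and $\Lambda\subseteq\Gamma$, $L((\Lambda))$ denotes the subset of elements $\sum_{\gamma\in\Lambda}a_\gamma r_\gamma$ with $r_\gamma\in L$ for all $\gamma\in\Lambda$. When $C_A(K)$ is a division algebra, $\mathcal{D}$ is a division algebra with center $F((\ker\varepsilon))$, equipped with the valuation $v(0)=\infty$, $v(S)=\min\,\mathrm{supp}(S)$ for $S\neq 0$, whose value group is $\Gamma$ and whose residue division algebra $\overline{\mathcal{D}}$ is $C_A(K)$ (the residue of $\sum_\gamma a_\gamma r_\gamma$ with $v\geq 0$ is $r_0$). For a subfield $L\subseteq\mathcal{D}$, $\overline{L}\subseteq C_A(K)$ denotes the residue field of $L$ for the restriction of $v$; it centralizes $K$, so the field compositum $\overline{L}K\subseteq C_A(K)$ makes sense. *)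

(* Defs.v *)
From HB Require Import structures.
From mathcomp Require Import all_boot all_order all_fingroup all_algebra.
From mathcomp Require Import all_field finmap.
From mathcomp Require Import boolp classical_sets functions cardinality fsbigop.

Set Implicit Arguments.
Unset Strict Implicit.
Unset Printing Implicit Defensive.

Import Order.TTheory GRing.Theory Num.Theory.

Local Open Scope classical_set_scope.
Local Open Scope ring_scope.

HB.mixin Record isOrderedAbelian G of Num.POrderedZmodule G := {
  ole_total : total (<=%R : rel G);
  oleD2l : forall x y z : G, x <= y -> z + x <= z + y
}.

(* porderZmodType does not require the order to be translation invariant. *)
#[short(type="orderedAbelianType")]
HB.structure Definition OrderedAbelian :=
  { G of Num.POrderedZmodule G & isOrderedAbelian G }.

Definition well_ordered d (T : porderType d) (S : set T) : Prop :=
  forall X : set T, X `<=` S -> X !=set0 ->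
    exists2 m, X m & forall x, X x -> (m <= x)%O.

Section Subfields.
Context {R : nzRingType}.
Implicit Types L M X Y : set R.

Definition is_subfield L : Prop :=
  [/\ L 1,
      forall x y, L x -> L y -> L (x - y),
      forall x y, L x -> L y -> L (x * y),
      forall x y, L x -> L y -> x * y = y * x &
      forall x, L x -> x != 0 -> exists2 y, L y & x * y = 1].

Definition is_maximal_subfield L : Prop :=
  is_subfield L /\ forall M, is_subfield M -> L `<=` M -> M = L.

Definition compositum X Y : set R := smallest is_subfield (X `|` Y).

(* L / M is a finite Galois extension: up to isomorphism it is a Galois
   extension E / k in the sense of the library (1%AS is k inside E). *)
Definition is_galois_extension M L : Prop :=
  exists (k : fieldType) (E : splittingFieldType k) (f : {rmorphism E -> R}),
    [/\ galois 1%AS {:E}%AS,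
        f @` [set` {:E}%AS] = L &
        f @` [set` (1%AS : {aspace E})] = M].

End Subfields.

(* The dimension of a set of vectors that is a subspace, 0 otherwise. *)
Definition set_dim (k : fieldType) (V : vectType k) (X : set V) : nat :=
  \dim (xget 0%VS [set U : {vspace V} | [set` U] = X]).

Definition scalars (k : fieldType) (A : falgType k) : set A :=
  [set a%:A | a in [set: k]].
Arguments scalars {k} A _.

Definition is_central_simple (k : fieldType) (A : falgType k) : Prop :=
  'Z({:A})%VS = 1%VS /\
  forall I : {vspace A}, (I * fullv <= I)%VS -> (fullv * I <= I)%VS ->
    I = 0%VS \/ I = fullv.

Section OrderedAbelianTheory.
Variable G : orderedAbelianType.
Implicit Types (x y z : G) (S T U : set G).

Lemma oleNgt x y : (x <= y) = ~~ (y < x).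
Proof. by apply: comparable_leNgt; exact: ole_total. Qed.

Lemma oltNge x y : (x < y) = ~~ (y <= x).
Proof. by rewrite oleNgt negbK. Qed.

Lemma oler2l z x y : (z + x <= z + y) = (x <= y).
Proof.
apply/idP/idP => [h|]; last exact: oleD2l.
by have := oleD2l _ _ (- z) h; rewrite !addKr.
Qed.

Lemma oltr2l z x y : (z + x < z + y) = (x < y).
Proof. by rewrite !oltNge oler2l. Qed.

Lemma olerD x y z t : x <= y -> z <= t -> x + z <= y + t.
Proof.
move=> xy zt; apply: (@le_trans _ _ (x + t)); first by rewrite oler2l.
by rewrite ![_ + t]addrC oler2l.
Qed.

Lemma well_orderedS S T : S `<=` T -> well_ordered T -> well_ordered S.
Proof. by move=> ST h X XS; apply: h => x /XS /ST. Qed.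

Lemma well_orderedU S T :
  well_ordered S -> well_ordered T -> well_ordered (S `|` T).
Proof.
move=> wS wT X XST [x0 Xx0].
have [[s Xs]|/forallNP XS] := pselect (exists s, (X `&` S) s); last first.
  apply: wT; last by exists x0.
  by move=> x Xx; case: (XST _ Xx) => // Sx; case: (XS x).
have [[t Xt]|/forallNP XT] := pselect (exists s, (X `&` T) s); last first.
  apply: wS; last by exists x0.
  by move=> x Xx; case: (XST _ Xx) => // Sx; case: (XT x).
have [||a [Xa _] am] := wS (X `&` S); [by move=> ? []|by exists s|].
have [||b [Xb _] bm] := wT (X `&` T); [by move=> ? []|by exists t|].
case/orP: (ole_total a b) => ab; [exists a => // | exists b => //] => x Xx.
  by case: (XST _ Xx) => ?; [exact: am | apply: le_trans ab _; exact: bm].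
by case: (XST _ Xx) => ?; [apply: le_trans ab _; exact: am | exact: bm].
Qed.

Lemma well_ordered0 : well_ordered (set0 : set G).
Proof. by move=> X X0 [x /X0]. Qed.

Lemma well_ordered1 x : well_ordered [set x].
Proof.
by move=> X X1 [y Xy]; exists y => // z /X1 ->; rewrite (X1 _ Xy).
Qed.

Definition sumset S T : set G := [set z | exists2 s, S s & T (z - s)].

Lemma well_ordered_sumset S T :
  well_ordered S -> well_ordered T -> well_ordered (sumset S T).
Proof.
move=> wS wT X XST [x0 Xx0]; apply: contrapT => /forall2NP noMin.
have desc x : X x -> exists2 y, X y & y < x.
  move=> Xx; case: (noMin x) => [/(_ Xx)[]|/existsNP[y] /not_implyP[Xy /negP]].
  by rewrite -oltNge; exists y.
pose low s x := S s /\ exists2 y, X y & y <= x /\ T (y - s).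
pose T' := [set t | T t /\ exists s, [/\ S s, X (s + t) &
   forall s', low s' (s + t) -> s <= s']].
have mkT' x : X x -> exists s t, [/\ T t, S s, X (s + t), s + t <= x &
    forall s', low s' (s + t) -> s <= s'].
  move=> Xx; have [s Ss Ts] := XST _ Xx.
  have [||m [Sm [y Xy [yx Ty]]] mmin] := wS [set s | low s x].
  - by move=> ? [].
  - by exists s; split => //; exists x.
  have ym : m + (y - m) = y by rewrite addrC subrK.
  exists m, (y - m); rewrite ym; split => //.
  move=> s' [Ss' [z Xz [zy Tz]]]; apply: mmin; split=> //.
  by exists z => //; split=> //; exact: le_trans zy yx.
have [||t [Tt [s [Ss Xst smin]]] tmin] := wT T'.
- by move=> ? [].
- have [s [t [Tt Ss Xst _ m]]] := mkT' _ Xx0.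
  by exists t; split => //; exists s.
have [y Xy yst] := desc _ Xst.
have [s1 [t1 [Tt1 Ss1 Xst1 le1 m1]]] := mkT' _ Xy.
have lt1 : s1 + t1 < s + t := le_lt_trans le1 yst.
have ss1 : s <= s1.
  apply: smin; split => //; exists (s1 + t1) => //; split; first exact: ltW.
  by rewrite addrC addKr.
have tt1 : t <= t1 by apply: tmin; split => //; exists s1.
by have := olerD ss1 tt1; rewrite oleNgt lt1.
Qed.

Lemma finite_of_well_ordered S : well_ordered S ->
  (forall X, X `<=` S -> X !=set0 -> exists2 m, X m & forall x, X x -> x <= m) ->
  finite_set S.
Proof.
move=> wS dS.
have [[s Ss]|/forallNP S0] := pselect (exists s, S s); last first.
  by have -> : S = set0 by apply/seteqP; split => // x /S0.
have [||m Sm mmax] := dS S; [by []|by exists s|].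
apply: contrapT => infS.
pose seg x := S `&` [set y | y <= x].
have [||x [Sx infx] xmin] := wS [set x | S x /\ ~ finite_set (seg x)].
- by move=> ? [].
- exists m; split => // fin; apply: infS; apply: sub_finite_set fin => y Sy.
  by split => //=; exact: mmax.
pose Y := S `&` [set y | y < x].
have [[y Yy]|/forallNP Y0] := pselect (exists y, Y y); last first.
  apply: infx; apply: (@sub_finite_set _ _ [set x]) => //.
  move=> y [Sy /=]; rewrite le_eqVlt => /predU1P[//|yx].
  by case: (Y0 y).
have [||z [Sz /= zx] zmax] := dS Y; [by move=> ? []|by exists y|].
have : ~ finite_set (seg z).
  move=> fin; apply: infx; apply: (@sub_finite_set _ _ (seg z `|` [set x])).
    move=> w [Sw /=]; rewrite le_eqVlt => /predU1P[->|wx]; first by right.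
    by left; split => //=; apply: zmax.
  by rewrite finite_setU.
by move=> infz; have := xmin z (conj Sz infz); rewrite oleNgt zx.
Qed.

Lemma finite_fibre S T z : well_ordered S -> well_ordered T ->
  finite_set [set s | S s /\ T (z - s)].
Proof.
move=> wS wT; apply: finite_of_well_ordered.
  by apply: well_orderedS wS => ? [].
move=> X XST [x Xx].
have [||m [y Xy <-] mmin] := wT [set z - s | s in X].
- by move=> _ [s /XST[_ Ts] <-].
- by exists (z - x), x.
exists y => // s Xs.
have /mmin : [set z - s | s in X] (z - s) by exists s.
rewrite oler2l => h.
by have := olerD h (lexx (s + y)); rewrite addKr addrCA addNr addr0.
Qed.

End OrderedAbelianTheory.

Section Convolution.
Variables (G : orderedAbelianType) (A : nzRingType).
Implicit Types (f g h : G -> A).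

Definition supp f : set G := [set x | f x != 0].

Lemma suppN f x : ~ supp f x -> f x = 0.
Proof. by move=> /negP/negPn/eqP. Qed.

Lemma fsum_seq (I : choiceType) (P : set I) (F : I -> A) : finite_set P ->
  (forall x, ~ P x -> F x = 0) ->
  \sum_(x \in [set: I]) F x = \sum_(x <- fset_set P) F x.
Proof.
move=> finP FP; rewrite -(fsbig_widen P) ?fsbig_finite //.
by move=> x [_ /FP].
Qed.

Definition conv f g : G -> A :=
  fun z => \sum_(x \in [set: G]) f x * g (z - x).

Lemma conv_seq f g z (P : set G) : finite_set P ->
  (forall x, supp f x -> supp g (z - x) -> P x) ->
  conv f g z = \sum_(x <- fset_set P) f x * g (z - x).
Proof.
move=> finP fgP; apply: fsum_seq => // x nPx.
have [/suppN ->|/contrapT sf] := pselect (~ supp f x); first by rewrite mul0r.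
by rewrite (@suppN g) ?mulr0 // => /(fgP _ sf).
Qed.

Lemma supp_conv f g : supp (conv f g) `<=` sumset (supp f) (supp g).
Proof.
move=> z; apply: contraPP => /forall2NP nz.
apply/negP/negPn/eqP.
rewrite (@conv_seq _ _ _ set0) //; first by rewrite fset_set0 big_nil.
by move=> x sf sg; case: (nz x).
Qed.

Lemma supp_convP f g : well_ordered (supp f) -> well_ordered (supp g) ->
  well_ordered (supp (conv f g)).
Proof.
by move=> wf wg; apply: (well_orderedS (@supp_conv f g)); exact: well_ordered_sumset.
Qed.

Lemma convA f g h : well_ordered (supp f) -> well_ordered (supp g) ->
  well_ordered (supp h) -> conv f (conv g h) = conv (conv f g) h.
Proof.
move=> wf wg wh; apply/funext => z.
pose P := [set a | sumset (supp f) (supp g) a /\ supp h (z - a)].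
have finP : finite_set P by apply: finite_fibre => //; exact: well_ordered_sumset.
pose Q := \bigcup_(a in P) [set b | supp f b /\ supp g (a - b)].
have finQ : finite_set Q by apply: bigcup_finite => // a _; exact: finite_fibre.
rewrite (@conv_seq (conv f g) h z P) //; last first.
  by move=> a /supp_conv.
rewrite (@conv_seq f (conv g h) z Q) //; last first.
  move=> b fb /supp_conv[c gc hc]; exists (b + c).
    split; last by rewrite opprD addrA.
    by exists b => //; rewrite addrAC subrr add0r.
  by split => //; rewrite addrAC subrr add0r.
under [RHS]eq_big_seq => a.
  rewrite in_fset_set // inE => Pa.
  rewrite (@conv_seq f g a Q) //; last by move=> b fb gb; exists a.
  rewrite big_distrl /=; over.
rewrite exchange_big /=; apply: eq_big_seq => b; rewrite in_fset_set // inE.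
move=> [a0 _ [fb _]].
rewrite /conv (reindex_fsbigT (fun a => a - b)) /=; last first.
  by exists (fun a => a + b) => a /=; rewrite ?subrK ?addrK.
rewrite (@fsum_seq _ P) //.
  rewrite big_distrr /=; apply: eq_bigr => a _.
  by rewrite mulrA opprB addrA subrK.
move=> a nPa.
have [/suppN ->|/contrapT sg] := pselect (~ supp g (a - b)); first by rewrite mul0r.
rewrite (@suppN h) ?mulr0 // opprB addrA subrK => sh.
by apply: nPa; split => //; exists b.
Qed.

Definition conv1 : G -> A := fun z => if z == 0 then 1 else 0.

Lemma conv1f f : conv conv1 f = f.
Proof.
apply/funext => z; rewrite (@conv_seq _ _ _ [set 0]) //.
  by rewrite fset_set1 big_seq_fset1 /conv1 eqxx mul1r subr0.
move=> x + _; rewrite /supp /conv1 /=.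
by case: (x =P 0) => [->|_] //; rewrite eqxx.
Qed.

Lemma convf1 f : conv f conv1 = f.
Proof.
apply/funext => z; rewrite (@conv_seq _ _ _ [set z]) //.
  by rewrite fset_set1 big_seq_fset1 /conv1 subrr eqxx mulr1.
move=> x _; rewrite /supp /conv1 /= subr_eq0.
by case: (z =P x) => [->|_] //; rewrite eqxx.
Qed.

Lemma convDl f g h : well_ordered (supp f) -> well_ordered (supp g) ->
  well_ordered (supp h) -> conv (f \+ g) h = conv f h \+ conv g h.
Proof.
move=> wf wg wh; apply/funext => z /=.
pose P := [set a | (supp f `|` supp g) a /\ supp h (z - a)].
have finP : finite_set P by apply: finite_fibre => //; exact: well_orderedU.
rewrite !(@conv_seq _ h z P) //; first last.
- move=> x fgx hx; split => //; apply: contrapT => /not_orP[/suppN f0 /suppN g0].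
  by move: fgx; rewrite /supp /= f0 g0 addr0 eqxx.
- by move=> x fx hx; split => //; left.
- by move=> x fx hx; split => //; right.
by rewrite -big_split /=; apply: eq_bigr => i _; rewrite mulrDl.
Qed.

Lemma convDr f g h : well_ordered (supp f) -> well_ordered (supp g) ->
  well_ordered (supp h) -> conv h (f \+ g) = conv h f \+ conv h g.
Proof.
move=> wf wg wh; apply/funext => z /=.
pose P := [set a | supp h a /\ (supp f `|` supp g) (z - a)].
have finP : finite_set P by apply: finite_fibre => //; exact: well_orderedU.
rewrite !(@conv_seq h _ z P) //; first last.
- move=> x hx fgx; split => //; apply: contrapT => /not_orP[/suppN f0 /suppN g0].
  by move: fgx; rewrite /supp /= f0 g0 addr0 eqxx.
- by move=> x fx hx; split => //; left.
- by move=> x fx hx; split => //; right.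
by rewrite -big_split /=; apply: eq_bigr => i _; rewrite mulrDr.
Qed.

End Convolution.

(* The field K is embedded in A by iota; this is the centralizer C_A(K). *)
Notation cent iota := (subvs_of 'C((iota @: fullv)%VS)%AS).

Section Centralizer.
Variables (F : fieldType) (A : falgType F) (K : splittingFieldType F).
Variable iota : 'AHom(K, A).

Local Notation cent := (cent iota).

Definition cent_field : set cent := [set c | vsval c \in (iota @: fullv)%VS].

Lemma cent_memP (a : A) :
  reflect (forall x, a * iota x = iota x * a) (a \in 'C(iota @: fullv)%VS).
Proof.
apply: (iffP centvP) => h x; first by apply: h; exact: memv_img (memvf _).
by case/memv_imgP => y _ ->.
Qed.

(* A choice of the elements u_s given by the Skolem-Noether theorem;
   gal_of {:K} is the group of all automorphisms of K over F. *)
Record skolem_noether := SkolemNoether {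
  sn_elt :> gal_of {:K}%AS -> A;
  sn_unit : forall s, sn_elt s \is a GRing.unit;
  sn_conj : forall (s : gal_of {:K}%AS) (x : K),
    iota (s x) = (sn_elt s)^-1 * iota x * sn_elt s;
  sn_id : sn_elt 1%g = 1
}.

Variable u : skolem_noether.

Lemma twist_subproof s (r : cent) :
  (u s)^-1 * vsval r * u s \in 'C(iota @: fullv)%VS.
Proof.
have us := sn_unit u s.
apply/cent_memP => x.
have ex : iota x = (u s)^-1 * iota ((s^-1)%g x) * u s.
  by rewrite -(sn_conj u) -galM ?memvf // mulVg gal_id.
have /cent_memP cr := valP r.
by rewrite ex !mulrA !mulrK //; congr (_ * _); rewrite -!mulrA cr.
Qed.

Lemma cocycle_subproof (s t : gal_of {:K}%AS) :
  (u (s * t)%g)^-1 * u s * u t \in 'C(iota @: fullv)%VS.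
Proof.
have us := sn_unit u s; have ut := sn_unit u t; have ust := sn_unit u (s * t)%g.
have e v x : iota x * u v = u v * iota (v x).
  by rewrite (sn_conj u) !mulrA divrr ?sn_unit // mul1r.
have e' v x : (u v)^-1 * iota x = iota (v x) * (u v)^-1.
  by rewrite (sn_conj u) mulrK ?sn_unit.
apply/cent_memP => x.
pose y := ((s * t)^-1)%g x.
have -> : x = t (s y).
  by rewrite -galM ?memvf // -galM ?memvf // mulVg gal_id.
rewrite -(mulrA _ (u t)) -e !mulrA -(mulrA _ (u s)) -e !mulrA e'.
by rewrite -galM ?memvf.
Qed.

Definition twist s (r : cent) : cent := Subvs (twist_subproof s r).

Definition cocycle (s t : gal_of {:K}%AS) : cent := Subvs (cocycle_subproof s t).

End Centralizer.

Arguments cent_field {F A K} iota _.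

Record addmul_hom (G : zmodType) (H : finGroupType) := AddMulHom {
  addmul_fun :> G -> H;
  addmul_funD : forall x y, addmul_fun (x + y) = (addmul_fun x * addmul_fun y)%g
}.

Definition addmul_ker G H (e : addmul_hom G H) : set G := [set x | e x = 1%g].

(* The series sum_g a_g r_g is represented by the function g |-> r_g. *)
Record mn_series (F : fieldType) (A : falgType F) (K : splittingFieldType F)
    (iota : 'AHom(K, A)) (Gamma : orderedAbelianType) :=
  MNSeries {
    mn_coef :> Gamma -> cent iota;
    mn_wo : well_ordered (supp mn_coef)
  }.
Arguments mn_wo {F A K iota Gamma} _.

(* u and eps do not occur in the elements but determine the product. *)
Definition mn_ring (F : fieldType) (A : falgType F) (K : splittingFieldType F)
    (iota : 'AHom(K, A)) (u : skolem_noether iota)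
    (Gamma : orderedAbelianType) (eps : addmul_hom Gamma (gal_of {:K}%AS)) :=
  mn_series iota Gamma.

Section MalcevNeumann.
Variables (F : fieldType) (A : falgType F) (K : splittingFieldType F).
Variables (iota : 'AHom(K, A)) (u : skolem_noether iota).
Variables (Gamma : orderedAbelianType).
Variable eps : addmul_hom Gamma (gal_of {:K}%AS).

Local Notation mn_ring := (mn_ring u eps).

Implicit Types x y z : mn_ring.

HB.instance Definition _ := gen_eqMixin mn_ring.
HB.instance Definition _ := gen_choiceMixin mn_ring.

Lemma mn_ext x y : mn_coef x =1 mn_coef y -> x = y.
Proof.
case: x y => [f hf] [g hg] /= /funext fg; case: _ / fg hg => hg.
by congr MNSeries; exact: Prop_irrelevance.
Qed.

Fact mn_zero_wo : well_ordered (supp (fun _ : Gamma => 0 : cent iota)).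
Proof.
by apply: (well_orderedS _ (@well_ordered0 Gamma)) => g; rewrite /supp /= eqxx.
Qed.
Definition mn_zero : mn_ring := MNSeries mn_zero_wo.

Fact mn_one_wo : well_ordered (supp (@conv1 Gamma (cent iota))).
Proof.
apply: (well_orderedS _ (@well_ordered1 Gamma 0)) => g; rewrite /supp /conv1 /=.
by case: (g =P 0) => // _; rewrite eqxx.
Qed.
Definition mn_one : mn_ring := MNSeries mn_one_wo.

Fact mn_opp_wo x : well_ordered (supp (fun g => - x g)).
Proof.
by apply: (well_orderedS _ (mn_wo x)) => g; rewrite /supp /= oppr_eq0.
Qed.
Definition mn_opp x : mn_ring := MNSeries (@mn_opp_wo x).

Fact mn_add_wo x y : well_ordered (supp (fun g => x g + y g)).
Proof.
apply: (well_orderedS _ (well_orderedU (mn_wo x) (mn_wo y))) => g.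
move=> xy; apply: contrapT => /not_orP[/suppN x0 /suppN y0].
by move: xy; rewrite /supp /= x0 y0 addr0 eqxx.
Qed.
Definition mn_add x y : mn_ring := MNSeries (@mn_add_wo x y).

(* (a_h r) (a_k s) = a_h a_k (u_(eps k)^-1 r u_(eps k)) s
     = a_(h+k) (u_(eps h eps k)^-1 u_(eps h) u_(eps k))
         (u_(eps k)^-1 r u_(eps k)) s,
   here with k = g - h. The sum has finite support. *)
Definition mn_mul_coef x y : Gamma -> cent iota := fun g =>
  \sum_(h \in [set: Gamma])
    cocycle u (eps h) (eps (g - h)) * twist u (eps (g - h)) (x h) * y (g - h).

(* The coefficients u_(eps g) r_g multiply by plain convolution. *)
Definition mn_emb (f : Gamma -> cent iota) : Gamma -> A :=
  fun g => u (eps g) * vsval (f g).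

Lemma mn_emb_inj f g : mn_emb f =1 mn_emb g -> f =1 g.
Proof. by move=> e a; move: (e a) => /(mulrI (sn_unit _ _))/val_inj. Qed.

Lemma supp_emb f : supp (mn_emb f) = supp f.
Proof.
apply/seteqP; split=> g; rewrite /supp /mn_emb /=; apply: contra => /eqP.
  by move=> ->; rewrite linear0 mulr0.
rewrite -(mulr0 (u (eps g))) => /(mulrI (sn_unit _ _)) e.
by apply/eqP/val_inj; rewrite [LHS]e linear0.
Qed.

Lemma mn_emb_mul x y : mn_emb (mn_mul_coef x y) = conv (mn_emb x) (mn_emb y).
Proof.
apply/funext => g.
pose P := [set h | supp x h /\ supp y (g - h)].
have finP : finite_set P by apply: finite_fibre; exact: mn_wo.
rewrite (@conv_seq _ _ _ _ _ P) //; last by rewrite !supp_emb.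
rewrite /mn_emb /mn_mul_coef (@fsum_seq _ _ P) //; last first.
  move=> h nP.
  have [/suppN xh|/contrapT xh] := pselect (~ supp x h).
    have -> : twist u (eps (g - h)) (x h) = 0.
      by apply: val_inj; rewrite /= xh linear0 mulr0 mul0r.
    by rewrite mulr0 mul0r.
  by rewrite (@suppN _ _ y) ?mulr0 // => yh; apply: nP.
rewrite linear_sum mulr_sumr; apply: eq_bigr => h _ /=.
have hg : h + (g - h) = g by rewrite addrC subrK.
rewrite -addmul_funD hg.
by rewrite !mulrA mulrV ?sn_unit // mul1r mulrK ?sn_unit.
Qed.

Fact mn_mul_wo x y : well_ordered (supp (mn_mul_coef x y)).
Proof.
rewrite -supp_emb mn_emb_mul; apply: supp_convP; rewrite supp_emb; exact: mn_wo.
Qed.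
Definition mn_mul x y : mn_ring := MNSeries (@mn_mul_wo x y).

Lemma mn_emb_wo x : well_ordered (supp (mn_emb x)).
Proof. by rewrite supp_emb; exact: mn_wo. Qed.

Lemma mn_emb_add x y : mn_emb (mn_add x y) = mn_emb x \+ mn_emb y.
Proof. by apply/funext => g; rewrite /mn_emb /= -mulrDr -linearD. Qed.

Lemma addmul_fun0 : eps 0 = 1%g.
Proof.
by apply: (mulgI (eps 0)); rewrite -addmul_funD addr0 mulg1.
Qed.

Lemma vsval_cent1 : vsval (1 : cent iota) = 1.
Proof.
have e : algid 'C(iota @: fullv)%AS * 1 = 1.
  exact: (algidl (centv1 _)).
by rewrite -[RHS]e mulr1.
Qed.

Lemma mn_emb_one : mn_emb mn_one = @conv1 Gamma A.
Proof.
apply/funext => g; rewrite /mn_emb /= /conv1; case: eqP => [->|_].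
  by rewrite addmul_fun0 sn_id mul1r vsval_cent1.
by rewrite linear0 mulr0.
Qed.

Lemma mn_emb_ext x y : mn_emb x = mn_emb y -> x = y.
Proof. by move=> e; apply/mn_ext/mn_emb_inj; rewrite e. Qed.

Fact mn_addA : associative mn_add.
Proof. by move=> x y z; apply: mn_ext => g /=; rewrite addrA. Qed.
Fact mn_addC : commutative mn_add.
Proof. by move=> x y; apply: mn_ext => g /=; rewrite addrC. Qed.
Fact mn_add0 : left_id mn_zero mn_add.
Proof. by move=> x; apply: mn_ext => g /=; rewrite add0r. Qed.
Fact mn_addN : left_inverse mn_zero mn_opp mn_add.
Proof. by move=> x; apply: mn_ext => g /=; rewrite addNr. Qed.

HB.instance Definition _ :=
  GRing.isZmodule.Build mn_ring mn_addA mn_addC mn_add0 mn_addN.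

Fact mn_mulA : associative mn_mul.
Proof.
move=> x y z; apply: mn_emb_ext; rewrite !mn_emb_mul convA //; exact: mn_emb_wo.
Qed.
Fact mn_mul1l : left_id mn_one mn_mul.
Proof.
by move=> x; apply: mn_emb_ext; rewrite mn_emb_mul mn_emb_one conv1f.
Qed.
Fact mn_mulr1 : right_id mn_one mn_mul.
Proof.
by move=> x; apply: mn_emb_ext; rewrite mn_emb_mul mn_emb_one convf1.
Qed.
Fact mn_mulDl : left_distributive mn_mul mn_add.
Proof.
move=> x y z; apply: mn_emb_ext.
by rewrite mn_emb_mul !mn_emb_add !mn_emb_mul convDl //; exact: mn_emb_wo.
Qed.
Fact mn_mulDr : right_distributive mn_mul mn_add.
Proof.
move=> x y z; apply: mn_emb_ext.
by rewrite mn_emb_mul !mn_emb_add !mn_emb_mul convDr //; exact: mn_emb_wo.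
Qed.
Fact mn_one_neq0 : mn_one != mn_zero.
Proof.
apply/eqP => /(congr1 (fun x => mn_coef x 0)) /= /eqP.
by rewrite /conv1 eqxx oner_eq0.
Qed.

HB.instance Definition _ := GRing.Zmodule_isNzRing.Build mn_ring
  mn_mulA mn_mul1l mn_mulr1 mn_mulDl mn_mulDr mn_one_neq0.

Fact mn_mono_wo (g : Gamma) (r : cent iota) :
  well_ordered (supp (fun h => if h == g then r else 0)).
Proof.
apply: (well_orderedS _ (@well_ordered1 Gamma g)) => h; rewrite /supp /=.
by case: (h =P g) => // _; rewrite eqxx.
Qed.

(* a_g r *)
Definition mn_mono (g : Gamma) (r : cent iota) : mn_ring := MNSeries (@mn_mono_wo g r).

Lemma mn_monoM g h r s :
  mn_mono g r * mn_mono h s =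
  mn_mono (g + h) (cocycle u (eps g) (eps h) * twist u (eps h) r * s).
Proof.
apply: mn_ext => z; transitivity (mn_mul_coef (mn_mono g r) (mn_mono h s) z) => //.
rewrite /mn_mul_coef (@fsum_seq _ _ [set g]) //; last first.
  move=> k /= /eqP /negPf ->.
  have -> t : twist u t (0 : cent iota) = 0.
    by apply: val_inj; rewrite /= mulr0 mul0r.
  by rewrite mulr0 mul0r.
rewrite fset_set1 big_seq_fset1 /= eqxx subr_eq [h + g]addrC.
by case: eqP => [->|_]; rewrite ?mulr0 // addrAC subrr add0r.
Qed.

(* r a_g = a_g (u_(eps g)^-1 r u_(eps g)) *)
Lemma mn_monoC g r : mn_mono 0 r * mn_mono g 1 = mn_mono g (twist u (eps g) r).
Proof.
rewrite mn_monoM add0r mulr1; congr mn_mono.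
apply: val_inj; rewrite /= addmul_fun0 mul1g sn_id mulr1.
by rewrite mulVr ?sn_unit // mul1r.
Qed.

(* L((Lambda)) *)
Definition mn_sub (L : set (cent iota)) (Lambda : set Gamma) : set mn_ring :=
  [set x | supp x `<=` Lambda /\ forall g, Lambda g -> L (x g)].

(* v(x) = min (supp x), with None for infinity. *)
Definition mn_val x : option Gamma :=
  let is_min g := supp x g /\ forall h, supp x h -> g <= h in
  if pselect (exists g, is_min g) is left e then Some (projT1 (cid e)) else None.

Definition mn_val_ge0 x : Prop := if mn_val x is Some g then 0 <= g else True.

Definition residue (L : set mn_ring) : set (cent iota) :=
  [set x 0 | x in L `&` [set x | mn_val_ge0 x]].

End MalcevNeumann.

(* Main.v *)
(* Write g = |G|, c = [C_A(K) : F], l = [Lbar : F], v for the valuation, and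
   let H <= G, of order h, be the image under eps of the value group v(L).

   L is its own centralizer in the division ring D, so by Jacobson density the
   operators x |-> sum_i l_i x d_i (with l_i in L) realize all matrix units on
   any finite L-independent family; as D is generated by g c elements over its
   central subfield F((ker eps)), which L contains, an L-independent family has
   at most sqrt(g c) elements. A basis of C_A(K) over Lbar multiplied by
   representatives of G/H gives such a family of (g/h)(c/l) elements, because
   their leading terms do not cancel. Hence g c <= (h l)^2.

   A subfield M' of the central simple algebra A satisfies
   [M' : F]^2 <= [A : F], and [A : F] <= g c because A is the sum of the
   u_s C_A(K). On the other hand, if x = a_g r + ... is in L, then conjugation
   by u_s r, with s = eps g, fixes Lbar and induces s on K, so Artin's argument
   yields [Lbar K : F] >= h l. Thus every subfield M' containing Lbar K has
   dimension at most that of Lbar K.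

   If L is Galois over F((ker eps)), its automorphisms are induced by inner
   automorphisms of D and therefore preserve v, so the minimal polynomial of a
   lift of b in Lbar reduces to a polynomial over F that has b as a root and
   splits in Lbar. Separability holds because the degree of b divides l. *)

From HB Require Import structures.
Require Import Defs.
From mathcomp Require Import all_boot all_order all_fingroup all_algebra.
From mathcomp Require Import all_field finmap.
From mathcomp Require Import boolp classical_sets functions cardinality fsbigop.

Set Implicit Arguments.
Unset Strict Implicit.
Unset Printing Implicit Defensive.

Import Order.TTheory GRing.Theory Num.Theory.

Local Open Scope classical_set_scope.
Local Open Scope ring_scope.

(** * Subfields of division rings *)

Definition division_ring (R : nzRingType) : Prop :=
  forall x : R, x != 0 -> exists y, y * x = 1 /\ x * y = 1.

Lemma sub_compositum (R : nzRingType) (X Y : set R) : X `|` Y `<=` compositum X Y.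
Proof. by move=> x XYx L' [_]; apply. Qed.

Section DivisionRing.
Variable R : nzRingType.
Hypothesis divR : division_ring R.
Implicit Types (x y : R) (X L M : set R).

Lemma division_mulf_eq0 x y : x * y = 0 -> x != 0 -> y = 0.
Proof.
by move=> xy0 /divR[x' [x'x _]]; rewrite -(mul1r y) -x'x -mulrA xy0 mulr0.
Qed.

Lemma division_mul_neq0 x y : x != 0 -> y != 0 -> x * y != 0.
Proof.
move=> x0 y0; apply/eqP => /division_mulf_eq0 /(_ x0) e.
by rewrite e eqxx in y0.
Qed.

Definition bicommutant X : set R :=
  [set b | forall c, (forall x, X x -> c * x = x * c) -> b * c = c * b].

Lemma sub_bicommutant X : X `<=` bicommutant X.
Proof. by move=> x Xx c cX; rewrite cX. Qed.

(** Elements of [X] commute with each other, so the bicommutant lies in the centralizer of [X],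
    which makes it commutative. Inverses exist because centralizers in a division ring are closed
    under inversion. *)
Lemma bicommutant_subfield X :
  (forall x y, X x -> X y -> x * y = y * x) -> is_subfield (bicommutant X).
Proof.
move=> commX; split.
- by move=> c _; rewrite mul1r mulr1.
- by move=> x y hx hy c cX; rewrite mulrBl mulrBr hx ?hy.
- by move=> x y hx hy c cX; rewrite -mulrA hy // !mulrA hx.
- by move=> x y hx hy; apply: hx => z Xz; apply: hy => t Xt; exact: commX.
- move=> x hx /divR[y [yx xy]]; exists y => // c cX.
  by rewrite -[c in y * c]mulr1 -xy [c * _]mulrA -(hx _ cX) !mulrA yx mul1r.
Qed.

(** [compositum] is an intersection; it is commutative and has inverses because some subfield
    contains [X] and [Y], namely the bicommutant of their union. *)
Lemma compositum_subfield X Y :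
  (forall x y, (X `|` Y) x -> (X `|` Y) y -> x * y = y * x) ->
  is_subfield (compositum X Y).
Proof.
move=> commXY; have bS := bicommutant_subfield commXY.
have bXY := @sub_bicommutant (X `|` Y).
have inb x : compositum X Y x -> bicommutant (X `|` Y) x by apply; split.
case: (bS) => _ _ _ commb invb.
split.
- by move=> L [] [].
- move=> x y hx hy L LXY; have [[_ h _ _ _] _] := LXY.
  by apply: h; [apply: hx | apply: hy].
- move=> x y hx hy L LXY; have [[_ _ h _ _] _] := LXY.
  by apply: h; [apply: hx | apply: hy].
- by move=> x y /inb hx /inb hy; apply: commb.
- move=> x hx x0; have [y by_ xy] := invb x (inb _ hx) x0.
  exists y => // L LXY; have [[_ _ _ _ h] _] := LXY.
  have [z Lz xz] := h x (hx _ LXY) x0.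
  (* Inverses are unique, so the one found in the bicommutant lies in every [L] of the
     intersection. *)
  suff -> : y = z by [].
  have [x' [x'x _]] := divR x0.
  by rewrite -(mul1r y) -x'x -mulrA xy -xz mulrA x'x mul1r.
Qed.

(** An [x] centralizing [L] can be adjoined: the bicommutant of [L] and [x] is a subfield above [L],
    hence equals [L]. *)
Lemma maximal_subfield_cent L : is_maximal_subfield L ->
  forall x, (forall l, L l -> l * x = x * l) -> L x.
Proof.
move=> [[_ _ _ commL _] maxL] x xL; pose X := L `|` [set x].
have commX y z : X y -> X z -> y * z = z * y.
  move=> [Ly|->] [Lz|->] //; [exact: commL | exact: xL | by rewrite xL].
have <- : bicommutant X = L.
  apply: maxL; first exact: bicommutant_subfield.
  by move=> y Ly; apply: sub_bicommutant; left.
by apply: sub_bicommutant; right.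
Qed.

End DivisionRing.

(** * Linear algebra over a subfield *)

Section SubfieldType.
Variables (R : nzRingType) (L : set R).

(* The proof is a phantom argument of the type, so that the field structure can
   be a canonical instance. *)
Definition subfield_pred of is_subfield L : pred R := fun x => `[< L x >].

Record subfield_type (h : is_subfield L) :=
  SubfieldElt { subfield_val : R; _ : subfield_pred h subfield_val }.
HB.instance Definition _ h := [isSub for @subfield_val h].
HB.instance Definition _ h := [Choice of subfield_type h by <:].

Fact subfield_pred_subring h : subring_closed (subfield_pred h).
Proof.
have [h1 hB hM _ _] := h; split => [|x y|x y]; rewrite /in_mem /=.
- exact/asboolP.
- by move=> /asboolP Lx /asboolP Ly; apply/asboolP/hB.
- by move=> /asboolP Lx /asboolP Ly; apply/asboolP/hM.
Qed.
HB.instance Definition _ h :=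
  GRing.isSubringClosed.Build R (subfield_pred h) (subfield_pred_subring h).
HB.instance Definition _ h :=
  [SubChoice_isSubNzRing of subfield_type h by <:].

Lemma subfield_valP h (x : subfield_type h) : L (val x).
Proof. exact/asboolP/(valP x). Qed.

Definition subfield_elt h (x : R) (Lx : L x) : subfield_type h :=
  @SubfieldElt h x (introT (asboolP _) Lx).

Fact subfield_mulC h : @commutative (subfield_type h) _ *%R.
Proof.
move=> x y; apply: val_inj; rewrite !rmorphM.
by have [_ _ _ hC _] := h; apply: hC; exact: subfield_valP.
Qed.
HB.instance Definition _ h :=
  GRing.PzSemiRing_hasCommutativeMul.Build (subfield_type h) (@subfield_mulC h).

Lemma subfield_val_eq0 h (x : subfield_type h) : (val x == 0) = (x == 0).
Proof. by rewrite -(inj_eq val_inj) (rmorph0 (val : subfield_type h -> R)). Qed.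

Fact subfield_inv_ex h (x : subfield_type h) :
  exists y : subfield_type h, (x != 0 -> y * x = 1) /\ (x == 0 -> y = 0).
Proof.
have [->|x0] := eqVneq x 0; first by exists 0.
have [_ _ _ _ hV] := h; have [||y Ly xy] := hV (val x).
- exact: subfield_valP.
- by rewrite subfield_val_eq0.
exists (subfield_elt h Ly); split => // _.
by apply: val_inj; rewrite mulrC rmorphM rmorph1.
Qed.

Definition subfield_inv h (x : subfield_type h) := projT1 (cid (subfield_inv_ex x)).

Fact subfield_mulVf h (x : subfield_type h) : x != 0 -> subfield_inv x * x = 1.
Proof. by rewrite /subfield_inv; case: cid => y []. Qed.

Fact subfield_inv0 h : subfield_inv (0 : subfield_type h) = 0.
Proof. by rewrite /subfield_inv; case: cid => y [_ h0] /=; exact: h0. Qed.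

HB.instance Definition _ h := GRing.ComNzRing_isField.Build (subfield_type h)
  (@subfield_mulVf h) (@subfield_inv0 h).

(** The coefficient matrix over the field [L] has more rows than columns, hence a nonzero left
    kernel. The relation is stated in [R], so that later arguments never meet [subfield_type]. *)
Lemma subfield_relation (hL : is_subfield L) (I J : finType)
    (c : I -> J -> R) :
    (forall i j, L (c i j)) -> (#|J| < #|I|)%N ->
  exists w : I -> R, [/\ forall i, L (w i), exists i, w i != 0 &
    forall j, \sum_i w i * c i j = 0].
Proof.
move=> Lc ltJI; pose T : fieldType := subfield_type hL.
pose M : 'M[T]_(#|I|, #|J|) :=
  \matrix_(i, j) subfield_elt hL (Lc (enum_val i) (enum_val j)).
have /rowV0Pn[v /sub_kermxP vM v0] : kermx M != 0.
  rewrite -mxrank_eq0 mxrank_ker -lt0n subn_gt0.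
  by apply: leq_ltn_trans ltJI; exact: rank_leq_col.
exists (fun i => val (v ord0 (enum_rank i))); split.
- by move=> i; exact: subfield_valP.
- have [|k vk] := existsP (_ : [exists k, v ord0 k != 0]).
    apply: contraR v0; rewrite negb_exists => /forallP h.
    by apply/eqP/rowP => k; rewrite mxE; apply/eqP; rewrite -[_ == _]negbK h.
  exists (enum_val k); rewrite enum_valK.
  by rewrite subfield_val_eq0.
- move=> j; have /(congr1 (fun A : 'rV_ _ => val (A ord0 (enum_rank j)))) := vM.
  rewrite !mxE (rmorph0 (val : T -> R)).
  rewrite (rmorph_sum (val : {rmorphism T -> R})) => e.
  apply: etrans e.
  rewrite (reindex (fun k : 'I_#|I| => enum_val k)) /=; last first.
    exact/onW_bij/enum_val_bij.
  by apply: eq_bigr => k _; rewrite enum_valK mxE /= enum_rankK.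
Qed.

End SubfieldType.

(** * Jacobson density and the bound on independent families *)

Section Density.
Variables (R : nzRingType) (L : set R).
Hypothesis (divR : division_ring R) (hL : is_subfield L).
Hypothesis centL : forall x, (forall l, L l -> l * x = x * l) -> L x.
Implicit Types (x y d l : R) (T U : R -> R).

Let LB : forall x y, L x -> L y -> L (x - y).
Proof. by case: hL. Qed.
Let LM : forall x y, L x -> L y -> L (x * y).
Proof. by case: hL. Qed.
Let LC : forall x y, L x -> L y -> x * y = y * x.
Proof. by case: hL. Qed.
Let L1 : L 1.
Proof. by case: hL. Qed.
Let L0 : L 0.
Proof. by rewrite -(subrr 1); apply: LB. Qed.
Let LN x : L x -> L (- x).
Proof. by rewrite -sub0r => ?; apply: LB. Qed.
Let LD x y : L x -> L y -> L (x + y).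
Proof. by move=> Lx Ly; rewrite -[y]opprK; apply/LB/LN. Qed.
Let Lsum (I : Type) (r : seq I) (F : I -> R) :
  (forall i, L (F i)) -> L (\sum_(i <- r) F i).
Proof. by move=> LF; elim/big_rec: _ => // i x _; exact: LD. Qed.

(** The image of L (x) R^op in the endomorphisms of [R]; [s] lists pure tensors. *)
Definition bimodule_op T : Prop := exists s : seq (R * R),
  (forall p, p \in s -> L p.1) /\ forall x, T x = \sum_(p <- s) p.1 * x * p.2.

Lemma bimodule_op_id : bimodule_op id.
Proof.
exists [:: (1, 1)]; split; first by move=> p; rewrite inE => /eqP ->.
by move=> x; rewrite big_seq1 mul1r mulr1.
Qed.

Lemma bimodule_opMr T d : bimodule_op T -> bimodule_op (fun x => T x * d).
Proof.
move=> [s [Ls Ts]]; exists [seq (p.1, p.2 * d) | p <- s]; split.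
  by move=> _ /mapP[p /Ls Lp ->].
move=> x; rewrite Ts mulr_suml big_map.
by apply: eq_bigr => p _; rewrite /= mulrA.
Qed.

Lemma bimodule_opMl T l : L l -> bimodule_op T -> bimodule_op (fun x => l * T x).
Proof.
move=> Ll [s [Ls Ts]]; exists [seq (l * p.1, p.2) | p <- s]; split.
  by move=> _ /mapP[p /Ls Lp ->]; exact: LM.
move=> x; rewrite Ts mulr_sumr big_map.
by apply: eq_bigr => p _; rewrite /= !mulrA.
Qed.

Lemma bimodule_opB T U :
  bimodule_op T -> bimodule_op U -> bimodule_op (fun x => T x - U x).
Proof.
move=> [s [Ls Ts]] [t [Lt Ut]].
exists (s ++ [seq (- p.1, p.2) | p <- t]); split.
  move=> p; rewrite mem_cat => /orP[/Ls //|/mapP[q /Lt Lq ->]].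
  exact: LN.
move=> x; rewrite Ts Ut big_cat big_map /= -sumrN; congr (_ + _).
by apply: eq_bigr => p _; rewrite !mulNr.
Qed.

Lemma bimodule_op_additive T x y :
  bimodule_op T -> T (x - y) = T x - T y.
Proof.
move=> [s [_ Ts]]; rewrite !Ts -sumrB.
by apply: eq_bigr => p _; rewrite mulrBr mulrBl.
Qed.

Lemma bimodule_op_scale T l x : bimodule_op T -> L l -> T (l * x) = l * T x.
Proof.
move=> [s [Ls Ts]] Ll; rewrite !Ts mulr_sumr; apply: eq_big_seq => p /Ls Lp.
by rewrite !mulrA (LC Lp Ll).
Qed.

(** Recursive, so that [bimodule_op_separates] can split off one generator at a time. *)
Fixpoint left_span (xs : seq R) x : Prop :=
  if xs is y :: ys then exists2 l, L l & left_span ys (x - l * y) else x = 0.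

Lemma left_spanP (I : eqType) (e : I -> R) (r : seq I) x :
  uniq r -> left_span (map e r) x ->
  exists2 w : I -> R, forall i, L (w i) & x = \sum_(i <- r) w i * e i.
Proof.
elim: r x => [|i r IH] x /=.
  by move=> _ ->; exists (fun=> 0) => //; rewrite big_nil.
move=> /andP[ir /IH{}IH] [l Ll /IH[w Lw e1]].
exists (fun j => if j == i then l else w j).
  by move=> j; case: eqP.
rewrite big_cons eqxx -[LHS](subrK (l * e i)) e1 addrC; congr (_ + _).
apply: eq_big_seq => j jr; case: eqP => // ji.
by rewrite -ji jr in ir.
Qed.

(* Jacobson density for R as a simple module over L (x) R^op, whose
   endomorphisms are the left multiplications by elements of L. *)
Lemma bimodule_op_separates xs x : left_span xs x \/
  exists T, [/\ bimodule_op T, forall y, y \in xs -> T y = 0 & T x != 0].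
Proof.
elim: xs x => [|y ys IH] x.
  have [->|x0] := eqVneq x 0; first by left.
  by right; exists id; split => //; exact: bimodule_op_id.
have kills T : (forall z, z \in ys -> T z = 0) -> T y = 0 ->
    forall z, z \in y :: ys -> T z = 0.
  by move=> Tys Ty z; rewrite inE => /predU1P[->|/Tys].
have [sy|[T0 [opT0 T0ys T0y]]] := IH y.
  have [sx|[T [opT Tys Tx]]] := IH x.
    left; exists 0; first exact: L0.
    by rewrite mul0r subr0.
  right; exists T; split => //; apply: kills => //.
  (* An [L]-linear [T] vanishing on [ys] vanishes on their span, which contains [y]. *)
  elim: (ys) (y) sy Tys => [_ -> _|z zs IHz t0 [l Ll /IHz{}IHz] Tzs].
    by have := bimodule_op_additive 0 0 opT; rewrite !subrr.
  have Tz : T z = 0 by apply: Tzs; rewrite inE eqxx.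
  have := bimodule_op_additive t0 (l * z) opT.
  rewrite (bimodule_op_scale z opT Ll) Tz mulr0 subr0 => <-; apply: IHz => t tzs.
  by apply: Tzs; rewrite inE tzs orbT.
have [d [_ T0yd]] := divR T0y.
pose T1 x := T0 x * d.
have opT1 : bimodule_op T1 by exact: bimodule_opMr.
have T1y : T1 y = 1 by [].
have T1ys z : z \in ys -> T1 z = 0 by move=> /T0ys e; rewrite /T1 e mul0r.
have [//|noT] := pselect (exists T, [/\ bimodule_op T,
  forall z, z \in y :: ys -> T z = 0 & T x != 0]); first by right.
left; pose m := T1 x.
(* If [T] kills [ys], subtracting [T1 z * T y] from [T z] gives an operator that also kills [y]; by
   [noT] it must kill [x]. *)
have key T : bimodule_op T -> (forall z, z \in ys -> T z = 0) -> T x = m * T y.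
  move=> opT Tys; apply/eqP; rewrite -subr_eq0; apply: contrapT => /negP h.
  apply: noT; exists (fun z => T z - T1 z * T y); split => //.
    by apply: bimodule_opB => //; exact: bimodule_opMr.
  apply: kills; first by move=> z zys; rewrite Tys // T1ys // mul0r subrr.
  by rewrite T1y mul1r subrr.
have Lm : L m.
  (* For the operator [l * T1 z], [key] reads [l * m = m * l]. *)
  apply: centL => l Ll; have := key (fun z => l * T1 z).
  rewrite T1y mulr1 => -> //; first exact: bimodule_opMl.
  by move=> z zys; rewrite T1ys // mulr0.
(* By [key] every operator killing [ys] kills [x - m * y], so the induction hypothesis puts this
   difference in the span of [ys]. *)
exists m => //; have [//|[T [opT Tys]]] := IH (x - m * y).
by rewrite bimodule_op_additive // bimodule_op_scale // key // subrr eqxx.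
Qed.

Definition left_independent (I : finType) (e : I -> R) : Prop :=
  forall w : I -> R, (forall i, L (w i)) -> \sum_i w i * e i = 0 ->
    forall i, w i = 0.

(** Independence keeps [e i] out of the span of the other members, so some operator kills these and
    not [e i]; a right multiplication normalizes its value to 1. *)
Lemma bimodule_op_dual (I : finType) (e : I -> R) i : left_independent e ->
  exists T, bimodule_op T /\ forall j, T (e j) = (j == i)%:R.
Proof.
move=> ei.
have [h|[T [opT T0 Ti]]] := bimodule_op_separates
    [seq e j | j <- rem i (index_enum I)] (e i).
  have [|w Lw e1] := left_spanP _ h; first exact/rem_uniq/index_enum_uniq.
  have := ei (fun j => if j == i then -1 else w j).
  case/(_ _ _ i)/Wrap => [j||]; first by case: eqP => // _; exact: LN.
    rewrite (big_rem i) ?mem_index_enum //= eqxx mulN1r e1 addrC.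
    apply/eqP; rewrite subr_eq0; apply/eqP; apply: eq_big_seq => j.
    by rewrite mem_rem_uniq ?index_enum_uniq // inE => /andP[/negPf ->].
  by rewrite eqxx => /eqP; rewrite oppr_eq0 oner_eq0.
have [d [_ Td]] := divR Ti.
exists (fun x => T x * d); split; first exact: bimodule_opMr.
move=> j; case: eqP => [-> //|/eqP ji]; rewrite T0 ?mul0r //.
apply: map_f.
by rewrite mem_rem_uniq ?index_enum_uniq // inE ji mem_index_enum.
Qed.

(** Central coefficients can be moved to the left, so every operator is a combination of the maps
    sending [x] to [x * b k], with coefficients in [L]. If the [#|I| ^ 2] matrix units [D i x * e j]
    outnumbered these maps, they would satisfy a relation over [L], and evaluating it at [e i] would
    give one among the [e j]. *)
Lemma left_independent_bound (I J : finType) (e : I -> R) (b : J -> R) :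
    left_independent e ->
    (forall x, exists z : J -> R, [/\ forall k, L (z k),
       forall k y, z k * y = y * z k & x = \sum_k z k * b k]) ->
  (#|I| ^ 2 <= #|J|)%N.
Proof.
move=> ei bJ; rewrite leqNgt; apply/negP => ltJI.
have opb T : bimodule_op T -> exists c : J -> R, (forall k, L (c k)) /\
    forall x, T x = \sum_k c k * x * b k.
  move=> [s [Ls Ts]]; pose z d := projT1 (cid (bJ d)).
  have zP d : [/\ forall k, L (z d k), forall k y, z d k * y = y * z d k &
     d = \sum_k z d k * b k] by rewrite /z; case: cid.
  (* Membership of [p.1] in [L] is known only for [p] in [s], hence the default 0. *)
  exists (fun k => \sum_(p <- s) (if p \in s then p.1 else 0) * z p.2 k).
  split=> [k|x].
    apply: Lsum => p; apply: LM; last by case: (zP p.2).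
    by case: ifP => [/Ls //|_].
  under [RHS]eq_bigr do rewrite !mulr_suml.
  rewrite Ts exchange_big /=; apply: eq_big_seq => p ps.
  have [_ zC dE] := zP p.2; rewrite ps {1}dE mulr_sumr; apply: eq_bigr => k _.
  by rewrite !mulrA -(mulrA p.1) -zC !mulrA.
pose D i := projT1 (cid (bimodule_op_dual i ei)).
have DP i : bimodule_op (D i) /\ forall j, D i (e j) = (j == i)%:R.
  by rewrite /D; case: cid.
have opD (p : I * I) : bimodule_op (fun x => D p.1 x * e p.2).
  by apply: bimodule_opMr; case: (DP p.1).
pose c p := projT1 (cid (opb _ (opD p))).
have cP p : (forall k, L (c p k)) /\
    forall x, D p.1 x * e p.2 = \sum_k c p k * x * b k.
  by rewrite /c; case: cid.
have [||w [Lw [[i j] wij] wc]] := @subfield_relation R L hL (I * I)%type J c.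
- by move=> p; case: (cP p).
- by rewrite card_prod mulnn.
have : \sum_j w (i, j) * e j = 0.
  transitivity (\sum_p w p * (D p.1 (e i) * e p.2)).
    transitivity (\sum_i' \sum_j w (i', j) * (D i' (e i) * e j)); last first.
      by rewrite pair_bigA; apply: eq_bigr => [[]].
    rewrite [RHS](bigD1 i) //= [X in _ = _ + X]big1 ?addr0; last first.
      move=> i' i'i; apply: big1 => k _; case: (DP i') => _ ->.
      by rewrite eq_sym (negPf i'i) mul0r mulr0.
    by apply: eq_bigr => k _; case: (DP i) => _ ->; rewrite eqxx mul1r.
  under eq_bigr => p _ do (case: (cP p) => _ ->; rewrite mulr_sumr).
  rewrite exchange_big big1 //= => k _.
  under eq_bigr do rewrite mulrA.
  rewrite -mulr_suml; under eq_bigr do rewrite mulrA.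
  by rewrite -mulr_suml wc !mul0r.
by move=> /ei -/(_ (fun j => Lw (i, j)) j) w0; rewrite w0 eqxx in wij.
Qed.

End Density.

(** * Simple algebras and Galois extensions *)

Section VectorSpaces.
Variables (k : fieldType).

(** A subspace of largest dimension inside [X] is all of [X], since adjoining a vector of [X] to it
    stays inside [X]. *)
Lemma set_vspace (V : vectType k) (X : set V) : X 0 ->
    (forall a x y, X x -> X y -> X (a *: x + y)) ->
  exists U : {vspace V}, [set` U] = X.
Proof.
move=> X0 XD.
pose P n := `[< exists2 U : {vspace V}, \dim U = n & [set` U] `<=` X >].
have exP : exists n, P n.
  exists 0; apply/asboolP; exists 0%VS; first exact: dimv0.
  by move=> x /=; rewrite memv0 => /eqP ->.
have bP n : P n -> (n <= \dim {:V})%N.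
  by move=> /asboolP[U <- _]; exact/dimvS/subvf.
case: (ex_maxnP exP bP) => n /asboolP[U <- UX] maxU.
exists U; apply/seteqP; split => // x Xx /=.
have sub : [set` (U + <[x]>)%VS] `<=` X.
  move=> _ /= /memv_addP[y Uy [_ /vlineP[a ->] ->]]; rewrite addrC.
  by apply: XD => //; exact: UX.
have : P (\dim (U + <[x]>)) by apply/asboolP; exists (U + <[x]>)%VS.
move=> /maxU dimU; have := dimv_leqif_eq (addvSl U <[x]>).
move/geq_leqif; rewrite dimU => /esym/eqP ->.
by apply: subvP (memv_line x); exact: addvSr.
Qed.

Lemma set_dimE (V : vectType k) (U : {vspace V}) : set_dim [set` U] = \dim U.
Proof.
rewrite /set_dim; case: xgetP => [W _ /= WU|/(_ U)[]//]; congr (\dim _).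
apply/vspaceP => x; have /(congr1 (fun X : set V => X x)) /= := WU.
by move=> e; apply/idP/idP; rewrite e.
Qed.

Lemma linear_inj_dim (V W : vectType k) (f : V -> W) (U : {vspace W}) :
    linear f -> (forall v, f v \in U) -> (forall v, f v = 0 -> v = 0) ->
  (\dim {:V} <= \dim U)%N.
Proof.
move=> linf fU inj0.
pose f' : {linear V -> W} := HB.pack f (GRing.isLinear.Build _ _ _ _ f linf).
have fE : linfun f' =1 f by move=> v; rewrite lfunE.
rewrite -(@limg_dim_eq _ _ _ (linfun f')) ?dimvS //.
  by apply/subvP => _ /memv_imgP[v _ ->]; rewrite fE.
apply/eqP; rewrite -subv0; apply/subvP => v /memv_capP[_].
by rewrite memv_ker fE memv0 => /eqP/inj0 ->.
Qed.

Lemma dim_subvs (V : vectType k) (U : {vspace V}) : \dim {:subvs_of U} = \dim U.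
Proof. by rewrite dimvf. Qed.

Lemma dim_ffun (I : finType) (V : vectType k) :
  \dim {: {ffun I -> V}} = (#|I| * \dim {:V})%N.
Proof. by rewrite !dimvf. Qed.

Lemma linear_surj_dim (V W : vectType k) (f : V -> W) :
  linear f -> (forall w, exists v, w = f v) -> (\dim {:W} <= \dim {:V})%N.
Proof.
move=> linf surj.
pose f' : {linear V -> W} := HB.pack f (GRing.isLinear.Build _ _ _ _ f linf).
rewrite -(limg_ker_dim (linfun f') fullv); apply: leq_trans (leq_addl _ _).
apply/dimvS/subvP => w _; have [v ->] := surj w.
by apply/memv_imgP; exists v; rewrite ?memvf // lfunE.
Qed.

End VectorSpaces.

Section ModuleBasis.
Variables (k : fieldType) (B : falgType k) (U : {aspace B}).
Hypothesis unitU : forall x, x \in U -> x != 0 -> x \is a GRing.unit.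

(** [U] is a division ring, so [B] is free as a left [U]-module: a longest list of nonzero [x] whose
    lines [U * <[x]>] form a direct sum generates [B]. Directness is expressed by the dimension of
    the sum. *)
Lemma module_basis : exists n (e : 'I_n -> B),
  [/\ (n * \dim U)%N = \dim {:B},
      forall x, exists2 w, (forall j, w j \in U) & x = \sum_j w j * e j &
      forall w, (forall j, w j \in U) -> \sum_j w j * e j = 0 ->
        forall j, w j = 0].
Proof.
pose W (s : seq B) := (\sum_(x <- s) U * <[x]>)%VS.
have dimUx y : y != 0 -> \dim (U * <[y]>) = \dim U.
  move=> y0; rewrite -limg_amulr limg_dim_eq //.
  apply/eqP; rewrite -subv0; apply/subvP => a /memv_capP[Ua].
  rewrite memv_ker lfunE /= memv0; apply: contraLR => a0.
  by rewrite (mulrI_eq0 _ (mulrI (unitU Ua a0))).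
pose P n := `[< exists s : seq B,
  [/\ size s = n, \dim (W s) = (n * \dim U)%N & 0 \notin s] >].
have exP : exists n, P n.
  by exists 0; apply/asboolP; exists [::]; rewrite /W big_nil dimv0.
have bP n : P n -> (n <= \dim {:B})%N.
  move=> /asboolP[s [_ dimW _]]; apply: leq_trans (dimvS (subvf (W s))).
  by rewrite dimW leq_pmulr ?adim_gt0.
case: (ex_maxnP exP bP) => n /asboolP[s [sz dimW s0]] maxn.
have modW : (U * W s <= W s)%VS.
  rewrite /W big_distrr /=.
  rewrite (eq_bigr (fun x => U * <[x]>)%VS) // => x _.
  by rewrite prodvA prodv_id.
have fullW : W s = fullv.
  apply/eqP; rewrite eqEsubv subvf /=; apply: contraT => /subvPn[y _ yW].
  have y0 : y != 0 by apply: contraNneq yW => ->; rewrite mem0v.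
  suff /maxn : P n.+1 by rewrite ltnn.
  apply/asboolP; exists (y :: s); split; first by rewrite /= sz.
    rewrite /W big_cons dimv_disjoint_sum ?dimUx // ?dimW ?mulSn //.
    apply/eqP; rewrite -subv0.
    apply/subvP => _ /memv_capP[/memv_cosetP[a Ua ->] ayW].
    rewrite memv0; apply: contraNT yW => ay0.
    have a0 : a != 0 by apply: contraNneq ay0 => ->; rewrite mul0r.
    (* If [a * y] is in [W s] for a unit [a] of [U], then so is [y], against its choice. *)
    rewrite -(mulKr (unitU Ua a0) y); apply: (subvP modW).
    by rewrite memv_mul ?memvV.
  by rewrite inE negb_or eq_sym y0.
have dirW : directv (\sum_(i < n) U * <[s`_i]>)%VS.
  rewrite directvEgeq /=.
  have -> : (\sum_(i < n) U * <[s`_i]>)%VS = W s.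
    by rewrite /W (big_nth 0) sz big_mkord.
  rewrite dimW -[n in (_ <= n * _)%N]card_ord -sum_nat_const; apply: leq_sum => i _.
  by rewrite dimUx // (memPn s0) // mem_nth // sz.
exists n, (fun i : 'I_n => s`_i); split.
- by rewrite -dimW fullW.
- move=> x; have : x \in W s by rewrite fullW memvf.
  rewrite /W (big_nth 0) sz big_mkord => /memv_sumP[v vU ->].
  have ex i : exists a, a \in U /\ v i = a * s`_i.
    by have /memv_cosetP[a Ua ->] := vU i isT; exists a.
  exists (fun i => projT1 (cid (ex i))).
    by move=> i; case: cid => a [].
  by apply: eq_bigr => i _; case: cid => a [].
- move=> w wU w0 j; have s_j : s`_j != 0 by rewrite (memPn s0) // mem_nth // sz.
  have := directv_sum_independent dirW (fun i => w i * s`_i).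
  case/(_ _ _ j isT)/Wrap => [i _||/eqP].
  - by rewrite memv_mul ?wU ?memv_line.
  - exact: w0.
  - apply: contraTeq => wj0.
    by rewrite (mulrI_eq0 _ (mulrI (unitU (wU j) wj0))).
Qed.

End ModuleBasis.

(** * Commutative subfields of a central simple algebra *)

Section CentralSimple.
Variables (k : fieldType) (B : falgType k).
Hypothesis csB : is_central_simple B.

Lemma central_scalar (a : B) : (forall x, a * x = x * a) -> exists c : k, a = c%:A.
Proof.
move=> ca; have : a \in 'Z({:B})%VS.
  by rewrite memv_cap memvf; apply/centvP => x _; exact: ca.
by case: csB => -> _ /vlineP.
Qed.

(** The first coefficients of all such relations form a two-sided ideal. If it is 0, induction
    applies. If it is everything, some relation starts with 1; its commutator with any [x] starts
    with 0 and vanishes by induction, so its other coefficients are scalars and its value at 1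
    contradicts freeness. *)
Lemma central_simple_independent (m : seq B) (a : nat -> B) : free m ->
    (forall x, \sum_(i < size m) m`_i * x * a i = 0) ->
  forall i, (i < size m)%N -> a i = 0.
Proof.
elim: m a => [|m0 m IH] a //= fm0 rel.
have fm : free m by move: fm0; rewrite free_cons => /andP[].
pose relation b :=
  forall x, m0 * x * b 0%N + \sum_(i < size m) m`_i * x * b i.+1 = 0.
have rel' : relation a by move=> x; have := rel x; rewrite big_ord_recl.
have tail b : relation b -> b 0%N = 0 -> forall i, (i < size m)%N -> b i.+1 = 0.
  move=> rb b0; apply: (IH (fun i => b i.+1)) => // x.
  by have := rb x; rewrite b0 mulr0 add0r.
have relMl b x : relation b -> relation (fun i => x * b i).
  move=> rb y; have := rb (y * x); rewrite !mulrA => e; apply: etrans e.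
  congr (_ + _).
  by apply: eq_bigr => i _; rewrite !mulrA.
have relMr b x : relation b -> relation (fun i => b i * x).
  move=> rb y; have /(congr1 ( *%R^~ x)) := rb y.
  rewrite mul0r mulrDl mulr_suml => e.
  apply: etrans e; rewrite !mulrA; congr (_ + _).
  by apply: eq_bigr => i _; rewrite !mulrA.
have relB b c : relation b -> relation c -> relation (fun i => b i - c i).
  move=> rb rc y.
  apply: etrans (etrans (congr2 (fun p q => p - q) (rb y) (rc y)) (subr0 0)).
  rewrite opprD addrACA -sumrB mulrBr.
  by congr (_ + _); apply: eq_bigr => i _; rewrite mulrBr.
have [I IE] : exists I : {vspace B},
    [set` I] = [set x | exists2 b, relation b & b 0%N = x].
  apply: set_vspace.
    exists (fun=> 0) => // x; rewrite mulr0 add0r big1 // => i _.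
    by rewrite mulr0.
  move=> c _ _ [b rb <-] [b' rb' <-].
  exists (fun i => b' i - (- c)%:A * b i) => //.
    by apply: relB => //; exact: relMl.
  by rewrite scaleNr mulNr opprK mulr_algl addrC.
have memI x : x \in I <-> exists2 b, relation b & b 0%N = x.
  by rewrite -[X in X <-> _]/([set` I] x) IE.
have [||I0|If] := proj2 csB I.
- apply/prodvP => _ y /memI[b rb <-] _; apply/memI.
  by exists (fun i => b i * y) => //; exact: relMr.
- apply/prodvP => y _ _ /memI[b rb <-]; apply/memI.
  by exists (fun i => y * b i) => //; exact: relMl.
- have a0 : a 0%N = 0.
    apply/eqP; rewrite -memv0 -I0; apply/memI; by exists a.
  by case=> [//|i]; exact: tail.
- have /memI[b rb b0] : 1 \in I by rewrite If memvf.
  have cb i : (i < size m)%N -> forall x, b i.+1 * x = x * b i.+1.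
    move=> im x; apply/esym/eqP; rewrite -subr_eq0; apply/eqP.
    apply: (tail (fun i => x * b i - b i * x)) im.
      by apply: relB; [exact: relMl | exact: relMr].
    by rewrite b0 mulr1 mul1r subrr.
  have ex i : exists c : k, (i < size m)%N -> b i.+1 = c%:A.
    case: (ltnP i (size m)) => im; last by exists 0.
    by have [c cE] := central_scalar (cb i im); exists c.
  pose c i := projT1 (cid (ex i)).
  have cE i : (i < size m)%N -> b i.+1 = (c i)%:A by rewrite /c; case: cid.
  move: (rb 1); rewrite b0 !mulr1 => m0E.
  move: fm0; rewrite free_cons => /andP[/negP[]].
  rewrite -[m0]opprK memvN; move/eqP: m0E; rewrite addr_eq0 => /eqP ->.
  rewrite opprK; apply: rpred_sum => i _.
  by rewrite mulr1 cE // mulr_algr memvZ // memv_span // mem_nth.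
Qed.

(* With r = \dim U and s = [B : U], the map a |-> (x |-> \sum_i m_i x a_i)
   embeds B^r in the U-linear endomorphisms of B, that is in B^s. *)
Lemma commutative_division_bound (U : {aspace B}) :
    (forall x, x \in U -> x != 0 -> x \is a GRing.unit) ->
    {in U &, commutative *%R} ->
  (\dim U ^ 2 <= \dim {:B})%N.
Proof.
move=> unitU commU; have [s [e [<- gen _]]] := module_basis unitU.
rewrite -mulnn leq_mul2r; apply/orP; right.
have B0 : (0 < \dim {:B})%N by rewrite dimvf; exact: FalgType_proper.
rewrite -(leq_pmul2r B0) -[s]card_ord -[\dim U]card_ord -!dim_ffun.
pose m := vbasis U.
pose f (a : {ffun 'I_(\dim U) -> B}) : {ffun 'I_s -> B} :=
  [ffun j : 'I_s => \sum_(i < \dim U) m`_i * e j * a i].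
apply: (@linear_inj_dim _ _ _ f) => [c a b|a|a fa0]; last 1 first.
- apply/ffunP => i; rewrite ffunE.
  have szm : size m = \dim U by rewrite size_tuple.
  (* [central_simple_independent] indexes coefficients by [nat]; out of range they are set to 0. *)
  pose a' i := if insub i is Some j then a j else 0.
  have a'E (j : 'I_(\dim U)) : a' j = a j by rewrite /a' valK.
  rewrite -a'E; apply: (@central_simple_independent m).
  + exact: basis_free (vbasisP U).
  + move=> x; have [w Uw ->] := gen x; rewrite szm.
    under eq_bigr do rewrite mulr_sumr mulr_suml a'E.
    rewrite exchange_big big1 //= => j _.
    (* The [w j] commute with the basis of [U], so vanishing at the generators [e j] gives vanishing
       at every [x]. *)
    have /ffunP/(_ j) := fa0; rewrite !ffunE => /(congr1 ( *%R (w j))).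
    rewrite mulr0 mulr_sumr => e0; apply: etrans e0; apply: eq_bigr => l _.
    have Um : m`_l \in U by apply: vbasis_mem; rewrite mem_nth // szm.
    by rewrite !mulrA (commU _ _ (Uw j) Um).
  + by rewrite szm.
- apply/ffunP => j; rewrite !ffunE scaler_sumr -big_split.
  by apply: eq_bigr => i _; rewrite !ffunE mulrDr -scalerAr.
- exact: memvf.
Qed.

End CentralSimple.

(** * Dual bases for the trace and isotypic components *)

Section GaloisDualBases.
Variables (k : fieldType) (E : splittingFieldType k).
Hypothesis galE : galois 1%AS {:E}%AS.
Local Notation GE := (gal_of {:E}%AS).

Definition gal_trace (z : E) : E := \sum_(s : GE) s z.

Lemma gal_scalar (s : GE) a : a \in 1%VS -> s a = a.
Proof. by move=> /vlineP[c ->]; rewrite rmorph_alg. Qed.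

Lemma gal_trace_scalar z : gal_trace z \in 1%VS.
Proof.
have -> : gal_trace z = galTrace 1%AS {:E}%AS z.
  rewrite /galTrace /gal_trace; apply: eq_bigl => s.
  rewrite gal_kHom ?sub1v //; apply/esym/kHomP_tmp; split=> [x|x y].
    exact: gal_scalar.
  by move=> _ _; rewrite rmorphM.
by apply: mem_galTrace; rewrite ?memvf.
Qed.

(** [x] is a family on which the automorphisms form an invertible matrix; [y] is the column of the
    inverse matrix at the identity. *)
Lemma gal_dual_bases : exists n (x y : 'I_n -> E),
  forall s : GE, \sum_i s (x i) * y i = (s == 1%g)%:R.
Proof.
pose GT := finset.setTfor GE; have GTs s : s \in GT by rewrite inE.
have [w _ [uM _ _]] := gal_matrix GT.
set M := \matrix_(i, j) _ in uM.
pose i0 : 'I_#|GT| := enum_rank_in (GTs 1%g) 1%g.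
exists #|GT|, (tnth w), (fun i => invmx M i i0) => s.
have /matrixP/(_ (enum_rank_in (GTs s) s) i0) := mulmxV uM.
rewrite !mxE /i0 => e; apply: etrans (etrans e _).
  by apply: eq_bigr => i _; rewrite mxE enum_rankK_in.
by rewrite -(inj_eq enum_val_inj) !enum_rankK_in.
Qed.

Variables (n : nat) (x y : 'I_n -> E).
Hypothesis dual : forall s : GE, \sum_i s (x i) * y i = (s == 1%g)%:R.

Lemma dual_expand_y z : \sum_i gal_trace (z * x i) * y i = z.
Proof.
under eq_bigr do rewrite mulr_suml; rewrite exchange_big /=.
rewrite (bigD1 (1%g : GE)) //= [X in _ + X]big1 ?addr0 => [|s s1]; last first.
  under eq_bigr do rewrite rmorphM -mulrA.
  by rewrite -mulr_sumr dual (negPf s1) mulr0.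
under eq_bigr do rewrite rmorphM -mulrA.
rewrite -mulr_sumr dual eqxx mulr1; exact: gal_id.
Qed.

Lemma dual_expand_x z : \sum_i gal_trace (z * y i) * x i = z.
Proof.
under eq_bigr do rewrite mulr_suml; rewrite exchange_big /=.
(* Applying [s] to the duality at [s^-1] exchanges the roles of [x] and [y]. *)
have dual' (s : GE) : \sum_i s (y i) * x i = (s == 1%g)%:R.
  transitivity (s (\sum_i (s^-1)%g (x i) * y i)).
    rewrite rmorph_sum; apply: eq_bigr => i _.
    by rewrite rmorphM /= -galM ?memvf // mulVg gal_id mulrC.
  by rewrite dual rmorph_nat eq_invg1.
rewrite (bigD1 (1%g : GE)) //= [X in _ + X]big1 ?addr0 => [|s s1]; last first.
  under eq_bigr do rewrite rmorphM -mulrA.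
  by rewrite -mulr_sumr dual' (negPf s1) mulr0.
under eq_bigr do rewrite rmorphM -mulrA.
rewrite -mulr_sumr dual' eqxx mulr1; exact: gal_id.
Qed.

Section Isotypic.
Variables (R : nzRingType) (f : {rmorphism E -> R}).
Hypothesis central : forall (a : E) r, a \in 1%VS -> f a * r = r * f a.

(** The sum of the tensors [y i] (x) [x i] is the separability idempotent of [E]. Twisted by [t], it
    projects [R] onto the elements [p] with [f (t l) * p = p * f l] for all [l]. *)
Definition isotypic_proj (t : GE) (r : R) : R := \sum_i f (t (y i)) * r * f (x i).

(** Multiplication by [l] has transposed matrices on the [y i] and on the [x j]; their entries, the
    traces [c i j], are central and can cross [r]. *)
Lemma isotypic_projP (t : GE) r l :
  f (t l) * isotypic_proj t r = isotypic_proj t r * f l.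
Proof.
pose c i j := gal_trace (y i * l * x j).
have cS i j : c i j \in 1%VS by exact: gal_trace_scalar.
transitivity (\sum_i \sum_j f (c i j) * (f (t (y j)) * r * f (x i))).
  rewrite mulr_sumr; apply: eq_bigr => i _.
  rewrite !mulrA -!rmorphM [l * _]mulrC -{1}(dual_expand_y (y i * l)).
  rewrite !rmorph_sum !mulr_suml; apply: eq_bigr => j _.
  by rewrite !rmorphM /= (gal_scalar _ (cS i j)) !mulrA.
rewrite exchange_big mulr_suml; apply: eq_bigr => j _.
rewrite -mulrA -rmorphM -(dual_expand_x (x j * l)) rmorph_sum mulr_sumr.
apply: eq_bigr => i _; rewrite rmorphM !mulrA.
have -> : gal_trace (x j * l * y i) = c i j.
  by rewrite /c mulrC [x j * l]mulrC mulrA.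
by rewrite -(mulrA (f (c i j))) (central (f (t (y j)) * r) (cS i j)).
Qed.

(** Summing over [t] turns [t (y i)] into a trace, which is central; what is left to the right of
    [r] is the expansion of 1. *)
Lemma isotypic_decomposition r : r = \sum_(t : GE) isotypic_proj t r.
Proof.
rewrite exchange_big /=; under eq_bigr do rewrite -!mulr_suml -rmorph_sum.
under eq_bigr => i _ do
  rewrite central ?gal_trace_scalar // -mulrA -rmorphM.
rewrite -mulr_sumr -rmorph_sum.
have := dual_expand_x 1; under eq_bigr do rewrite mul1r.
by move=> ->; rewrite rmorph1 mulr1.
Qed.

End Isotypic.
End GaloisDualBases.

(** * The Mal'cev-Neumann division ring *)

Section OrderedAbelianExtra.
Variable G : orderedAbelianType.
Implicit Types x y z : G.

Lemma olt_total x y : [\/ x < y, x = y | y < x].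
Proof.
have [xy|] := boolP (x <= y); last by rewrite -oltNge; constructor 3.
by move: xy; rewrite le_eqVlt => /predU1P[->|]; [constructor 2|constructor 1].
Qed.

Lemma ofin_min (I : finType) (P : pred I) (f : I -> G) i0 : P i0 ->
  exists2 i, P i & forall j, P j -> f i <= f j.
Proof.
move=> Pi0; have : i0 \in [seq i <- enum I | P i].
  by rewrite mem_filter Pi0 mem_enum.
have : forall j, P j -> j \in [seq i <- enum I | P i].
  by move=> j Pj; rewrite mem_filter Pj mem_enum.
have : forall j, j \in [seq i <- enum I | P i] -> P j.
  by move=> j; rewrite mem_filter => /andP[].
move: [seq i <- enum I | P i] => s sP Ps i0s.
suff [i /sP Pi imin] : exists2 i, i \in s & forall j, j \in s -> f i <= f j.
  by exists i => // j /Ps; exact: imin.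
elim: s i0 i0s {sP Ps Pi0} => // k s IH i0 _.
case: s IH => [_|k' s IH].
  by exists k; rewrite ?inE // => j; rewrite inE => /eqP ->.
have [i is_ imin] := IH k' (mem_head _ _).
case/orP: (ole_total (f k) (f i)) => ki.
  exists k; first exact: mem_head.
  by move=> j; rewrite inE => /predU1P[->//|/imin]; exact: le_trans.
exists i; first by rewrite inE is_ orbT.
by move=> j; rewrite inE => /predU1P[->//|/imin].
Qed.

End OrderedAbelianExtra.

Section MalcevNeumannTheory.
Variables (F : fieldType) (A : falgType F) (K : splittingFieldType F).
Variables (iota : 'AHom(K, A)) (u : skolem_noether iota).
Variables (Gamma : orderedAbelianType).
Variable eps : addmul_hom Gamma (gal_of {:K}%AS).
Hypothesis divC : forall c : cent iota, c != 0 -> c \is a GRing.unit.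

Local Notation C := (cent iota).
Local Notation D := (mn_ring u eps).
Implicit Types (x y z : D) (g h k : Gamma) (r c : C) (s t : gal_of {:K}%AS).

Lemma cent_division : division_ring C.
Proof. by move=> c /divC Uc; exists c^-1; rewrite mulVr ?mulrV. Qed.

Lemma cent_mul_eq0 r c : r * c = 0 -> r != 0 -> c = 0.
Proof. exact: (division_mulf_eq0 cent_division). Qed.

Lemma vsvalM r c : vsval (r * c) = vsval r * vsval c.
Proof. by []. Qed.

Lemma vsval_inj : injective (vsval : C -> A).
Proof. exact: val_inj. Qed.

Lemma vsval_eq0 r : (vsval r == 0) = (r == 0).
Proof. by rewrite -(inj_eq vsval_inj) linear0. Qed.

Lemma twist0 s : twist u s 0 = 0.
Proof. by apply: vsval_inj; rewrite /= mulr0 mul0r. Qed.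

Lemma twist_eq0 s r : (twist u s r == 0) = (r == 0).
Proof.
rewrite -!vsval_eq0 /=; apply/eqP/eqP => [|->]; last by rewrite mulr0 mul0r.
move=> /(congr1 (fun a => u s * a / u s)).
by rewrite -!mulrA mulrV ?sn_unit // mulr1 mulVKr ?sn_unit // mul0r mulr0.
Qed.

Lemma twistM s r c : twist u s (r * c) = twist u s r * twist u s c.
Proof. by apply: vsval_inj; rewrite /= !mulrA mulrK ?sn_unit. Qed.

Lemma vsval_scalar (a : F) : vsval (a%:A : C) = a%:A.
Proof. by rewrite -(vsval_cent1 iota). Qed.

Lemma twist_scalar s (a : F) : twist u s a%:A = a%:A.
Proof.
apply: vsval_inj; change ((u s)^-1 * vsval (a%:A : C) * u s = vsval (a%:A : C)).
by rewrite vsval_scalar -scalerAr -scalerAl mulr1 mulVr ?sn_unit.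
Qed.

Lemma twistD s r c : twist u s (r + c) = twist u s r + twist u s c.
Proof. by apply: vsval_inj; rewrite /= mulrDr mulrDl. Qed.

Lemma cocycle_neq0 s t : cocycle u s t != 0.
Proof.
rewrite -vsval_eq0 /=.
apply/eqP => /(congr1 (fun a => u (s * t)%g * a / u t / u s)).
rewrite !mulrA mulrV ?sn_unit // mul1r mulrK ?sn_unit // mulrV ?sn_unit //.
by rewrite mulr0 !mul0r => /eqP; rewrite oner_eq0.
Qed.

Lemma cocycle1g s : cocycle u 1%g s = 1.
Proof.
apply: vsval_inj; rewrite /= mul1g sn_id mulr1 mulVr ?sn_unit //.
exact: esym (vsval_cent1 iota).
Qed.

Lemma cocycleg1 s : cocycle u s 1%g = 1.
Proof.
apply: vsval_inj; rewrite /= mulg1 sn_id mulr1 mulVr ?sn_unit //.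
exact: esym (vsval_cent1 iota).
Qed.

Lemma twistid r : twist u 1%g r = r.
Proof. by apply: vsval_inj; rewrite /= sn_id invr1 mul1r mulr1. Qed.

Lemma mn_coefD x y g : (x + y) g = x g + y g.
Proof. by []. Qed.

Lemma mn_coef0 g : (0 : D) g = 0.
Proof. by []. Qed.

Lemma mn_coefB x y g : (x - y) g = x g - y g.
Proof. by []. Qed.

Lemma mn_coef1 g : (1 : D) g = (g == 0)%:R.
Proof. by rewrite [LHS]/(conv1 _ g) /conv1; case: eqP. Qed.

Lemma mn_coef_sum (I : Type) (q : seq I) (P : pred I) (f : I -> D) g :
  (\sum_(i <- q | P i) f i) g = \sum_(i <- q | P i) f i g.
Proof. exact: (big_morph (fun x : D => x g)). Qed.

Lemma mn_coefM x y g : (x * y) g = \sum_(h \in [set: Gamma])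
  cocycle u (eps h) (eps (g - h)) * twist u (eps (g - h)) (x h) * y (g - h).
Proof. by []. Qed.

(** In degree [g + k] only the index [g] contributes. The coefficients at [g] and [k] may vanish, so
    [g = k = 0] covers all integral series. *)
Lemma mn_coefM_low x y g k : (forall h, h < g -> x h = 0) ->
    (forall h, h < k -> y h = 0) ->
  (forall h, h < g + k -> (x * y) h = 0) /\
  (x * y) (g + k) = cocycle u (eps g) (eps k) * twist u (eps k) (x g) * y k.
Proof.
move=> xg yk.
have zero h h' : h' < g \/ h - h' < k ->
    cocycle u (eps h') (eps (h - h')) * twist u (eps (h - h')) (x h') * y (h - h')
    = 0.
  by move=> [/xg ->|/yk ->]; rewrite ?mulr0 // twist0 mulr0 mul0r.
split=> [h hgk|].
  rewrite mn_coefM (@fsum_seq _ _ set0) ?fset_set0 ?big_nil // => h' _.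
  apply: zero; have [|gh'] := boolP (h' < g); first by left.
  right; rewrite oltNge; apply: contraL hgk => kh; rewrite -oleNgt.
  rewrite -[h](subrK h') [_ + h']addrC; apply: olerD => //.
  by rewrite oleNgt.
rewrite mn_coefM (@fsum_seq _ _ [set g]) //.
  by rewrite fset_set1 big_seq_fset1 addrC addKr.
move=> h /eqP hg; apply: zero.
case: (olt_total h g) => [| /eqP|gh]; [by left | by rewrite (negPf hg) |].
by right; rewrite -(oltr2l h) addrC subrK [h + k]addrC [g + k]addrC oltr2l.
Qed.

Definition is_val x g : Prop := x g != 0 /\ forall h, h < g -> x h = 0.

Lemma is_val_ex x : x != 0 -> exists g, is_val x g.
Proof.
move=> x0; have [||g xg gmin] := mn_wo x (supp x) => //.
  apply: contrapT => /forallNP sx; case/eqP: x0; apply: mn_ext => g.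
  by rewrite mn_coef0; apply: suppN; exact: sx.
exists g; split => // h hg; apply/eqP; apply: contrapT => /negP /gmin.
by rewrite oleNgt hg.
Qed.

Lemma is_val_neq0 x g : is_val x g -> x != 0.
Proof. by move=> [xg _]; apply: contraNneq xg => ->. Qed.

Lemma is_val_uniq x g h : is_val x g -> is_val x h -> g = h.
Proof.
move=> [xg ming] [xh minh]; case: (olt_total g h) => // [/minh e|/ming e].
  by rewrite e eqxx in xg.
by rewrite e eqxx in xh.
Qed.

Lemma is_valM x y g h : is_val x g -> is_val y h -> is_val (x * y) (g + h).
Proof.
move=> [xg ming] [yh minh]; have [low top] := mn_coefM_low ming minh.
split=> //; rewrite top; have mul0 := division_mul_neq0 cent_division.
by rewrite !mul0 ?cocycle_neq0 ?twist_eq0.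
Qed.

Lemma mn_mono_val g r : r != 0 -> is_val (mn_mono u eps g r) g.
Proof.
by move=> r0; split=> [|h]; rewrite /= ?eqxx // => /lt_eqF ->.
Qed.

Lemma mn_val_ge0P x : mn_val_ge0 x <-> forall h, h < 0 -> x h = 0.
Proof.
rewrite /mn_val_ge0 /mn_val; case: pselect => [e|/forallNP noval].
  case: (cid e) => g [xg ming] /=; split=> [g0 h h0|low].
    apply: suppN => /ming; rewrite oleNgt => /negP; apply.
    exact: lt_le_trans g0.
  by rewrite oleNgt; apply: contra xg => /low ->.
split=> // _ h _; suff -> : x = 0 by [].
apply/eqP; apply: contrapT => /negP /is_val_ex[g [xg ming]].
apply: (noval g); split => // h' xh'; rewrite oleNgt.
by apply: contra xh' => /ming ->.
Qed.

(** * Inverses of series *)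

Section RightInverse.
Variables (x : D) (d : Gamma).
Hypothesis xd : is_val x d.

(* y solves the equation x y = 1 up to the top of its support. *)
Definition partial_inverse y : Prop :=
  forall g, y g != 0 -> forall h, h <= g -> (1 - x * y) (d + h) = 0.

Lemma coefM_eq0 y g : (forall h, h <= g -> y h = 0) ->
  forall h, h <= g -> (x * y) (d + h) = 0.
Proof.
move=> yg h hg; have [->|y0] := eqVneq y 0; first by rewrite mulr0.
have [k yk] := is_val_ex y0; have [_] := is_valM xd yk; apply.
rewrite oltr2l; apply: le_lt_trans hg _; rewrite oltNge; apply/negP => /yg e.
by case: yk; rewrite e eqxx.
Qed.

(** At the first index [k] where [y] and [y'] differ, [x * (y - y')] is nonzero at [d + k], whereas
    for [k <= h] both remainders vanish there. *)
Lemma partial_inverse_agree y y' g h : partial_inverse y -> partial_inverse y' ->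
  y g != 0 -> h <= g -> y' h != 0 -> y h = y' h.
Proof.
move=> py py' yg hg y'h; have [->//|] := eqVneq y y'.
rewrite -subr_eq0 => /is_val_ex[k vk].
have [top _] := is_valM xd vk.
suff hk : h < k.
  by apply/eqP; rewrite -subr_eq0 -mn_coefB; apply/eqP; case: vk => _; apply.
rewrite oltNge; apply: contraNN top => kh.
rewrite mulrBr.
have -> : x * y - x * y' = (1 - x * y') - (1 - x * y) :> D.
  by rewrite opprB [RHS]addrC addrA subrK.
rewrite mn_coefB (py' h y'h k kh) (py g yg k (le_trans kh hg)).
by rewrite subrr.
Qed.

(** All partial inverses glued together; by [partial_inverse_agree] the choice of [y] does not
    affect the value. *)
Definition limit_coef h : C :=
  if pselect (exists2 y, partial_inverse y & y h != 0) is left e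
  then projT1 (cid2 e) h else 0.

Lemma limit_coef_eq y g h :
  partial_inverse y -> y g != 0 -> h <= g -> limit_coef h = y h.
Proof.
move=> py yg hg; rewrite /limit_coef; case: pselect => [e|noy].
  case: (cid2 e) => y' py' y'h /=.
  by rewrite (partial_inverse_agree py py' yg hg).
by apply/eqP; rewrite eq_sym; apply: contrapT => /negP yh; apply: noy; exists y.
Qed.

Lemma limit_coefN0 h : limit_coef h != 0 ->
  exists2 y, partial_inverse y & y h != 0.
Proof. by rewrite /limit_coef; case: pselect => // _; rewrite eqxx. Qed.

(** Up to any [h0] in its support, the limit coincides with a single series. *)
Fact limit_wo : well_ordered (supp limit_coef).
Proof.
move=> X sX [h0 Xh0]; have [y py yh0] := limit_coefN0 (sX _ Xh0).
have [||m [Xm mh0] mmin] := mn_wo y (X `&` [set h | h <= h0]).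
- by move=> h [Xh hh0]; rewrite /supp /= -(limit_coef_eq py yh0 hh0); exact: sX.
- by exists h0; split => /=.
exists m => // h Xh; have [hh0|] := boolP (h <= h0); first exact: mmin.
by rewrite -oltNge => /ltW; exact: le_trans.
Qed.

Definition limit_series : D := MNSeries limit_wo.

Lemma limit_partial : partial_inverse limit_series.
Proof.
move=> g /limit_coefN0[y py yg] h hg.
have -> : 1 - x * limit_series = (1 - x * y) - x * (limit_series - y).
  by rewrite mulrBr opprB addrA subrK.
rewrite mn_coefB (py g yg h hg) (@coefM_eq0 _ g) ?subrr // => k kg.
by rewrite mn_coefB [limit_series k](limit_coef_eq py yg kg) subrr.
Qed.

(** If a remainder survived, with leading index [d + g], then [g] would lie above the support of the
    limit. Adding a monomial at [g] that cancels the leading term would give a partial inverse with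
    [g] in its support, so the limit would be nonzero at [g]. *)
Lemma right_inverse_ex : exists y, x * y = 1.
Proof.
exists limit_series; apply/eqP; rewrite eq_sym -subr_eq0.
apply: contrapT => /negP /is_val_ex[c]; rewrite -[c](subrK d) [_ + d]addrC.
move: (c - d) => g {c} [top low].
have below h : limit_series h != 0 -> h < g.
  move=> lh; rewrite oltNge; apply/negP => /(limit_partial lh) e.
  by rewrite e eqxx in top.
pose a := cocycle u (eps d) (eps g) * twist u (eps g) (x d).
have Ua : a \is a GRing.unit.
  apply/divC/(division_mul_neq0 cent_division); first exact: cocycle_neq0.
  by rewrite twist_eq0; case: xd.
(* [x * m] has coefficient [a * r] at [d + g], which has to match the remainder. *)
pose r := a^-1 * (1 - x * limit_series) (d + g).
have r0 : r != 0.
  apply: contraNneq top => /(congr1 ( *%R a)); rewrite mulVKr // mulr0 => ->.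
  by rewrite eqxx.
pose m := mn_mono u eps g r.
have lg : limit_series g = 0.
  by apply/eqP; apply: contrapT => /negP /below; rewrite ltxx.
have pm : partial_inverse (limit_series + m).
  move=> h lh k kh; have kg : k <= g.
    apply: le_trans kh _; rewrite oleNgt; apply/negP => gh.
    move: lh; rewrite mn_coefD /= (gt_eqF gh) addr0 => /below.
    by rewrite oltNge ltW.
  have -> : 1 - x * (limit_series + m) = (1 - x * limit_series) - x * m.
    by rewrite mulrDr opprD addrA.
  have [mlow mtop] := mn_coefM_low (proj2 xd) (proj2 (mn_mono_val g r0)).
  rewrite mn_coefB; move: kg; rewrite le_eqVlt => /predU1P[->|kg].
    by rewrite mtop /= eqxx -/a mulVKr // subrr.
  by rewrite low ?mlow ?subrr // oltr2l.
have lmg : (limit_series + m) g != 0 by rewrite mn_coefD lg add0r /= eqxx.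
have := limit_coef_eq pm lmg (lexx g).
rewrite -[limit_coef g]/(limit_series g) lg => e.
by rewrite -e eqxx in lmg.
Qed.

End RightInverse.

Lemma mn_division : division_ring D.
Proof.
move=> x x0; have inv (z : D) : z != 0 -> exists y, z * y = 1.
  by move=> /is_val_ex[d]; exact: right_inverse_ex.
have [y xy] := inv x x0; exists y; split => //.
have [|z yz] := inv y; last first.
  by rewrite -[RHS]yz; congr (y * _); rewrite -[LHS]mulr1 -yz mulrA xy mul1r.
by apply: contra_eq_neq xy => ->; rewrite mulr0 eq_sym oner_neq0.
Qed.

(** * The central subfield and generators over it *)

Local Notation fullG := (finset.setTfor (gal_of {:K}%AS)).
Local Notation Z := (mn_sub (u := u) (scalars C) (addmul_ker eps)).

Lemma Z_coef x h : Z x -> (eps h = 1%g /\ exists a : F, x h = a%:A) \/ x h = 0.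
Proof.
move=> [sx Zx]; have [xh|/contrapT/sx eh] := pselect (~ supp x h).
  by right; exact: suppN.
by left; split => //; have [a _ <-] := Zx h eh; exists a.
Qed.

(** Indices in the kernel and coefficients in [F] make the twist and the cocycle trivial, which
    leaves a plain convolution. *)
Lemma Z_coefMl x y g : Z x ->
  (x * y) g = \sum_(h \in [set: Gamma]) x h * y (g - h).
Proof.
move=> Zx; rewrite mn_coefM; apply: eq_fsbigr => h _.
have [[-> [a ->]]|->] := Z_coef h Zx.
  by rewrite cocycle1g mul1r twist_scalar.
by rewrite twist0 mulr0.
Qed.

Lemma Z_coefMr x y g : Z x ->
  (y * x) g = \sum_(h \in [set: Gamma]) y h * x (g - h).
Proof.
move=> Zx; rewrite mn_coefM; apply: eq_fsbigr => h _.
have [[-> [a ->]]|->] := Z_coef (g - h) Zx.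
  by rewrite cocycleg1 twistid mul1r.
by rewrite !mulr0.
Qed.

Lemma Z_comm x y : Z x -> x * y = y * x.
Proof.
move=> Zx; apply: mn_ext => g; rewrite Z_coefMl // Z_coefMr //.
rewrite (reindex_fsbigT (fun h => g - h)) /=; last first.
  by exists (fun h => g - h) => h /=; rewrite subKr.
apply: eq_fsbigr => h _; rewrite subKr.
have [[_ [a ->]]|->] := Z_coef (g - h) Zx; last by rewrite mul0r mulr0.
by rewrite -scalerAl -scalerAr mul1r mulr1.
Qed.

Lemma mn_coefM_mono x h c g : (x * mn_mono u eps h c) g =
  cocycle u (eps (g - h)) (eps h) * twist u (eps h) (x (g - h)) * c.
Proof.
rewrite mn_coefM (@fsum_seq _ _ [set g - h]) //.
  by rewrite fset_set1 big_seq_fset1 subKr /= eqxx.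
move=> k kgh /=; case: eqP => [e|]; last by rewrite mulr0.
by case: kgh; rewrite /= -e subKr.
Qed.

Lemma mn_coefM_const x c g : (x * mn_mono u eps 0 c) g = x g * c.
Proof.
by rewrite mn_coefM_mono subr0 addmul_fun0 cocycleg1 twistid mul1r.
Qed.

Hypothesis eps_surj : forall s : gal_of {:K}%AS, exists g : Gamma, eps g = s.

Definition lift s : Gamma := projT1 (cid (eps_surj s)).

Lemma liftK s : eps (lift s) = s.
Proof. by rewrite /lift; case: cid. Qed.

Lemma eps_eq g h : (eps (g - h) == 1%g) = (eps g == eps h).
Proof.
rewrite -[in RHS](subrK h g) addmul_funD.
apply/eqP/eqP => [->|]; first by rewrite mul1g.
by move=> e; apply: (mulIg (eps h)); rewrite e mul1g.
Qed.

(** These are the coefficients of [Z_generators]: the part of [x] on one coset of the kernel,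
    shifted into the kernel and read in one coordinate [phi]. *)
Fact slice_wo x g (phi : C -> F) : phi 0 = 0 -> well_ordered
  (supp (fun h => if eps h == 1%g then (phi (x (h + g)))%:A else 0 : C)).
Proof.
move=> phi0 X sX [h0 Xh0].
have [||m Xm mmin] := mn_wo x [set h | X (h - g)].
- move=> h /sX; rewrite /supp /= subrK; apply: contraNN => /eqP ->.
  by rewrite phi0 scale0r if_same.
- by exists (h0 + g); rewrite /= addrK.
exists (m - g) => // h Xh; have := mmin (h + g); rewrite /= addrK => /(_ Xh).
by rewrite -(oler2l (- g)) addrC addrCA [- g + g]addrC subrr addr0.
Qed.

(** The support is split along the cosets of the kernel, the coefficients along a basis over [F]. *)
Lemma Z_generators x : exists z : (gal_of {:K}%AS * 'I_(\dim {:C})) -> D,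
  (forall p, Z (z p)) /\
  x = \sum_p z p * mn_mono u eps (lift p.1) (vbasis {:C})`_p.2.
Proof.
have phi0 (j : 'I_(\dim {:C})) : coord (vbasis {:C}) j 0 = 0 by rewrite linear0.
pose z (p : gal_of {:K}%AS * 'I_(\dim {:C})) : D :=
  MNSeries (@slice_wo x (lift p.1) _ (phi0 p.2)).
have Zz p : Z (z p).
  split=> [h|h hker]; rewrite /supp /=; last first.
    by rewrite hker eqxx; exists (coord (vbasis {:C}) p.2 (x (h + lift p.1))).
  by case: (eps h =P 1%g) => [//|_]; rewrite eqxx.
exists z; split=> //; apply: mn_ext => g; rewrite mn_coef_sum.
pose t s (j : 'I_(\dim {:C})) : C :=
  if eps g == s then coord (vbasis {:C}) j (x g) *: (vbasis {:C})`_j else 0.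
have zt p : (z p * mn_mono u eps (lift p.1) (vbasis {:C})`_p.2) g = t p.1 p.2.
  rewrite mn_coefM_mono /t.
  rewrite -[z p _]/(if eps (g - lift p.1) == 1%g then
    (coord (vbasis {:C}) p.2 (x (g - lift p.1 + lift p.1)))%:A else 0).
  rewrite eps_eq liftK; case: eqP => [e|_]; last by rewrite twist0 mulr0 mul0r.
  rewrite twist_scalar subrK.
  have /eqP -> : eps (g - lift p.1) == 1%g by rewrite eps_eq liftK e.
  by rewrite cocycle1g mul1r -scalerAl mul1r.
rewrite (eq_bigr _ (fun p _ => zt p)) -(pair_bigA _ t) /=.
rewrite (bigD1 (eps g)) //= [X in _ + X]big1 ?addr0; last first.
  by move=> s sg; apply: big1 => j _; rewrite /t eq_sym (negPf sg).
rewrite {1}(coord_vbasis (memvf (x g))); apply: eq_bigr => j _.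
by rewrite /t eqxx.
Qed.

(** * Residue field and values of a subfield *)

Section Residue.
Variable L : set D.
Hypotheses (hL : is_subfield L)
  (centL : forall x, (forall l, L l -> l * x = x * l) -> L x).

Let LM x y : L x -> L y -> L (x * y).
Proof. by case: hL => _ _ h _ _; exact: h. Qed.
Let LC x y : L x -> L y -> x * y = y * x.
Proof. by case: hL => _ _ _ h _; exact: h. Qed.

Lemma Z_sub x : Z x -> L x.
Proof. by move=> Zx; apply: centL => l _; rewrite (Z_comm _ Zx). Qed.

Lemma subfield_mn_inv x g : L x -> is_val x g ->
  exists y, [/\ L y, y * x = 1, x * y = 1 & is_val y (- g)].
Proof.
move=> Lx vx; have [_ _ _ _ hV] := hL.
have [y Ly xy] := hV x Lx (is_val_neq0 vx).
have y0 : y != 0.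
  by apply: contra_eq_neq xy => ->; rewrite mulr0 eq_sym oner_neq0.
exists y; split => //; first by rewrite LC.
have [h vy] := is_val_ex y0; have := is_valM vx vy.
have v1 : is_val (1 : D) 0.
  split=> [|k k0]; rewrite mn_coef1 ?eqxx ?oner_neq0 //.
  by rewrite (lt_eqF k0).
rewrite xy => /is_val_uniq/(_ v1)/eqP; rewrite addrC addr_eq0 => /eqP <-.
by [].
Qed.

Lemma residueP r : residue L r <->
  exists x, [/\ L x, forall h, h < 0 -> x h = 0 & x 0 = r].
Proof.
split=> [[x [Lx /mn_val_ge0P x0] <-]|[x [Lx x0 <-]]]; first by exists x.
by exists x => //; split => //; apply/mn_val_ge0P.
Qed.

Lemma mn_coefM0 x y : (forall h, h < 0 -> x h = 0) ->
    (forall h, h < 0 -> y h = 0) ->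
  (forall h, h < 0 -> (x * y) h = 0) /\ (x * y) 0 = x 0 * y 0.
Proof.
move=> x0 y0; have := mn_coefM_low x0 y0.
by rewrite addr0 !addmul_fun0 cocycle1g twistid mul1r.
Qed.

Lemma Z_scalar (a : F) : Z (mn_mono u eps 0 a%:A).
Proof.
split=> [h|h _]; last first.
  by rewrite /=; case: (h =P 0) => _; [exists a | exists 0 => //; rewrite scale0r].
rewrite /supp /=; case: (h =P 0) => [-> _|_]; last by rewrite eqxx.
exact: addmul_fun0.
Qed.

Lemma residue_scalar (a : F) : residue L a%:A.
Proof.
apply/residueP; exists (mn_mono u eps 0 a%:A); split.
- exact/Z_sub/Z_scalar.
- by move=> h /= /lt_eqF ->.
- by rewrite /= eqxx.
Qed.

Lemma residue_subfield : is_subfield (residue L).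
Proof.
have [_ LB _ _ _] := hL.
split.
- by have := residue_scalar 1; rewrite scale1r.
- move=> _ _ /residueP[x [Lx x0 <-]] /residueP[y [Ly y0 <-]]; apply/residueP.
  exists (x - y); split; [exact: LB | | by []].
  by move=> h h0; rewrite mn_coefB x0 // y0 // subrr.
- move=> _ _ /residueP[x [Lx x0 <-]] /residueP[y [Ly y0 <-]]; apply/residueP.
  by have [? ?] := mn_coefM0 x0 y0; exists (x * y); split => //; exact: LM.
- move=> _ _ /residueP[x [Lx x0 <-]] /residueP[y [Ly y0 <-]].
  have [_ <-] := mn_coefM0 x0 y0; have [_ <-] := mn_coefM0 y0 x0.
  by rewrite LC.
- move=> _ /residueP[x [Lx x0 <-]] xn0.
  have [|y [Ly yx xy vy]] := @subfield_mn_inv x 0 Lx; first by split.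
  rewrite oppr0 in vy; exists (y 0).
    by apply/residueP; exists y; split => //; case: vy.
  have [_ <-] := mn_coefM0 x0 (proj2 vy).
  by rewrite xy mn_coef1 eqxx.
Qed.

Definition value_image : {set gal_of {:K}%AS} :=
  [set s | `[< exists x g, [/\ L x, is_val x g & eps g = s] >]]%SET.

Lemma value_imageP s :
  reflect (exists x g, [/\ L x, is_val x g & eps g = s]) (s \in value_image).
Proof. by rewrite inE; exact: asboolP. Qed.

Fact value_image_group : group_set value_image.
Proof.
apply/group_setP; split.
  apply/value_imageP; exists 1, 0; split; [by case: hL | | exact: addmul_fun0].
  split=> [|k k0]; rewrite mn_coef1 ?eqxx ?oner_neq0 //.
  by rewrite (lt_eqF k0).
move=> _ _ /value_imageP[x [g [Lx vx <-]]] /value_imageP[y [h [Ly vy <-]]].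
apply/value_imageP; exists (x * y), (g + h); split; first exact: LM.
  exact: is_valM.
exact: addmul_funD.
Qed.
Canonical value_group := Group value_image_group.

(* Comparing leading coefficients in x l = l x. *)
Lemma residue_conj s : s \in value_image -> exists2 r : C, r != 0 &
  forall b, residue L b -> twist u s b * r = r * b.
Proof.
move=> /value_imageP[l [g [Ll vl <-]]]; exists (l g); first by case: vl.
move=> _ /residueP[x [Lx x0 <-]].
have [_] := mn_coefM_low x0 (proj2 vl).
have [_] := mn_coefM_low (proj2 vl) x0.
rewrite addr0 add0r LC // addmul_fun0 cocycle1g cocycleg1 twistid !mul1r.
by move=> -> ->.
Qed.

Section Independence.
Variables (n : nat) (c : 'I_n -> C).
Hypothesis indep_c : forall w : 'I_n -> C, (forall j, residue L (w j)) ->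
  \sum_j w j * c j = 0 -> forall j, w j = 0.

(** Dividing by an [l i] of least value makes all coefficients integral, with residue 1 at [i].
    Independence of the [c j] over the residue field makes the residue of the sum nonzero, so the
    original sum has the value of [l i]. *)
Lemma residue_indep_val (l : 'I_n -> D) j0 :
    (forall j, L (l j)) -> l j0 != 0 ->
  exists g, [/\ eps g \in value_image &
    is_val (\sum_j l j * mn_mono u eps 0 (c j)) g].
Proof.
move=> Ll lj0; pose P j := l j != 0.
have ex j : exists g, P j -> is_val (l j) g.
  have [l0|l0] := eqVneq (l j) 0; first by exists 0; rewrite /P l0 eqxx.
  by have [g vg] := is_val_ex l0; exists g.
pose v j := projT1 (cid (ex j)).
have vP j : P j -> is_val (l j) (v j) by rewrite /v; case: cid.
have [i Pi imin] := @ofin_min _ _ P v j0 lj0.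
exists (v i); split.
  by apply/value_imageP; exists (l i), (v i); split => //; exact: vP.
have [m [Lm ml lm vm]] := subfield_mn_inv (Ll i) (vP i Pi).
set X := \sum_j _.
have ge0 j : forall h, h < 0 -> (m * l j) h = 0.
  have [l0|Pj] := eqVneq (l j) 0; first by rewrite l0 mulr0.
  have [_ low] := is_valM vm (vP j Pj).
  move=> h h0; apply: low; apply: lt_le_trans h0 _.
  by rewrite -(addNr (v i)) oler2l; exact: imin.
have vmX : is_val (m * X) 0.
  rewrite mulr_sumr; split.
    rewrite mn_coef_sum; apply/negP => /eqP.
    under eq_bigr do rewrite mulrA mn_coefM_const.
    case/indep_c/(_ i)/Wrap => [j|/eqP].
      by apply/residueP; exists (m * l j); split => //; [exact: LM | exact: ge0].
    by rewrite ml mn_coef1 eqxx oner_eq0.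
  move=> h h0; rewrite mn_coef_sum big1 // => j _.
  by rewrite mulrA mn_coefM_const ge0 ?mul0r.
have := is_valM (vP i Pi) vmX.
by rewrite mulrA lm mul1r addr0.
Qed.

Let I : finType := ({a : {set gal_of {:K}%AS} |
  a \in rcosets value_image fullG} * 'I_n)%type.

Let rep (a : {a : {set gal_of {:K}%AS} |
  a \in rcosets value_image fullG}) := lift (repr (val a)).

Let rep_coset a : val a = (value_image :* eps (rep a))%g.
Proof.
by rewrite /rep liftK; case: a => _ /= /rcosetsP[s _ ->]; rewrite rcoset_repr.
Qed.

Let e (p : I) : D := mn_mono u eps 0 (c p.2) * mn_mono u eps (rep p.1) 1.

(** The partial sum [X a] has its value in v(L) up to the kernel of [eps], so its product with the
    representative has a value that [eps] maps into the coset [a]. Distinct cosets thus give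
    distinct values, and the term of least value cannot cancel. *)
Lemma residue_independent : left_independent L e.
Proof.
move=> w Lw e0 p; apply/eqP; apply: contrapT => /negP wp.
pose X a := \sum_j w (a, j) * mn_mono u eps 0 (c j).
have sumX : \sum_a X a * mn_mono u eps (rep a) 1 = 0.
  rewrite -[RHS]e0 (eq_bigr (fun p => (fun a j => w (a, j)
    * (mn_mono u eps 0 (c j) * mn_mono u eps (rep a) 1)) p.1 p.2)); last by case.
  rewrite -(pair_bigA _ (fun a j => w (a, j)
    * (mn_mono u eps 0 (c j) * mn_mono u eps (rep a) 1))) /=.
  by apply: eq_bigr => a _; rewrite mulr_suml; apply: eq_bigr => j _; rewrite mulrA.
pose P a := X a != 0.
have PX a j : w (a, j) != 0 -> exists g, eps g \in value_image /\ is_val (X a) g.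
  move=> waj; have [|g [? ?]] := @residue_indep_val (fun j => w (a, j)) j _ waj.
    by move=> k; exact: Lw.
  by exists g.
have ex a : exists g, P a -> eps g \in value_image /\ is_val (X a) g.
  have [[j waj]|/forallNP no] := pselect (exists j, w (a, j) != 0).
    by have [g vg] := PX a j waj; exists g.
  exists 0; rewrite /P /X big1 ?eqxx // => j _.
  by have /negP/negPn/eqP -> := no j; rewrite mul0r.
pose v a := projT1 (cid (ex a)).
have vP a : P a -> eps (v a) \in value_image /\ is_val (X a) (v a).
  by rewrite /v; case: cid.
have [|a Pa amin] := @ofin_min _ _ P (fun a => v a + rep a) p.1.
  have [|g [_ vg]] := PX p.1 p.2; first by case: (p) wp.
  exact: is_val_neq0 vg.
have val_term b : P b ->
    is_val (X b * mn_mono u eps (rep b) 1) (v b + rep b).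
  by move=> /vP[_ vb]; apply: is_valM vb _; apply: mn_mono_val; exact: oner_neq0.
have /(congr1 (fun x : D => x (v a + rep a))) := sumX.
rewrite mn_coef_sum (bigD1 a) // big1 ?Monoid.mulm1 => [e1|b ba].
  by have [h _] := val_term a Pa; rewrite e1 mn_coef0 eqxx in h.
have [Xb|Pb] := eqVneq (X b) 0; first by rewrite Xb mul0r.
have [_ low] := val_term b Pb; apply: low.
(* Equal values would put both representatives in the same coset. *)
move: (amin b Pb); rewrite le_eqVlt => /predU1P[eab|//].
case/eqP: ba; apply: val_inj; rewrite !rep_coset; apply/esym.
apply: (@rcoset_eqP _ value_group).
have [va _] := vP a Pa; have [vb _] := vP b Pb.
move/(congr1 eps): eab; rewrite !addmul_funD => eab.
rewrite mem_rcoset; have -> : (eps (rep a) * (eps (rep b))^-1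
    = (eps (v a))^-1 * eps (v b))%g.
  by apply: (mulgI (eps (v a))); rewrite mulgA eab mulgK mulKVg.
by rewrite (@groupM _ value_group) // (@groupV _ value_group).
Qed.

(** [L] contains the central subfield, so the generators of [D] over the latter satisfy the
    condition of [left_independent_bound]. *)
Lemma residue_bound :
  ((#|fullG : value_image|%g * n) ^ 2
     <= #|fullG| * \dim {:C})%N.
Proof.
have -> : (#|fullG : value_image|%g * n)%N = #|{: I}|.
  by rewrite card_prod card_ord card_sig.
have -> : (#|fullG| * \dim {:C})%N
    = #|{: gal_of {:K}%AS * 'I_(\dim {:C})}|.
  by rewrite card_prod card_ord cardsT.
pose b (p : gal_of {:K}%AS * 'I_(\dim {:C})) : D :=
  mn_mono u eps (lift p.1) (vbasis {:C})`_p.2.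
apply: (@left_independent_bound D L mn_division hL centL I _ e b
  residue_independent) => x.
have [z [Zz ->]] := Z_generators x; exists z; split => //.
  by move=> k; exact/Z_sub.
by move=> k y; exact: Z_comm.
Qed.

End Independence.
End Residue.

End MalcevNeumannTheory.

(** * Maximality of the compositum *)

Section SubfieldSpaces.
Variables (k : fieldType) (B : falgType k).

Lemma subfield_aspace (X : set B) : is_subfield X -> (forall a : k, X a%:A) ->
  exists U : {aspace B}, [set` U] = X.
Proof.
move=> [X1 XB XM _ _] Xk.
have X0 : X 0 by rewrite -(subrr 1); exact: XB.
have [|U UX] := @set_vspace k B X X0.
  move=> a x y Xx Xy; rewrite -mulr_algl -[y]opprK; apply: (XB); first exact: XM.
  by rewrite -sub0r; exact: XB.
have UE x : x \in U <-> X x by rewrite -[X in X <-> _]/([set` U] x) UX.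
have Ua : is_aspace U.
  rewrite /is_aspace has_algid1; last exact/UE.
  by apply/prodvP => x y /UE Xx /UE Xy; apply/UE/XM.
by exists (ASpace Ua).
Qed.

Lemma subfield_unit (X : set B) x : is_subfield X -> X x -> x != 0 ->
  x \is a GRing.unit.
Proof.
move=> [_ _ _ commX invX] Xx x0; have [y Xy xy] := invX x Xx x0.
by apply/unitrP; exists y; rewrite xy commX.
Qed.

End SubfieldSpaces.

Section Centralizer.
Variables (F : fieldType) (A : falgType F) (K : splittingFieldType F).
Variables (iota : 'AHom(K, A)) (u : skolem_noether iota).
Hypotheses (csA : is_central_simple A) (galK : galois 1%AS {:K}%AS).

Local Notation C := (cent iota).
Local Notation G := (gal_of {:K}%AS).
Local Notation fullG := (finset.setTfor G).

Lemma iota_comm (a b : K) : iota a * iota b = iota b * iota a.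
Proof. by rewrite -!rmorphM mulrC. Qed.

Fact cent_elt_subproof (a : K) : iota a \in 'C((iota @: fullv)%VS)%AS.
Proof. by apply/cent_memP => x; exact: iota_comm. Qed.

Definition cent_elt (a : K) : C := Subvs (cent_elt_subproof a).

Lemma cent_fieldE c : cent_field iota c <-> exists a, c = cent_elt a.
Proof.
split=> [/memv_imgP[a _ ca]|[a ->]]; last exact/memv_img/memvf.
by exists a; apply: val_inj.
Qed.

Lemma cent_eltM a b : cent_elt (a * b) = cent_elt a * cent_elt b.
Proof. by apply: val_inj; rewrite /= rmorphM. Qed.

Lemma cent_elt_sum (I : Type) (r : seq I) (P : pred I) (f : I -> K) :
  cent_elt (\sum_(i <- r | P i) f i) = \sum_(i <- r | P i) cent_elt (f i).
Proof.
apply: (big_morph cent_elt) => [a b|]; first by apply: val_inj; rewrite /= rmorphD.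
by apply: val_inj; rewrite /= rmorph0.
Qed.

Lemma cent_elt1 : cent_elt 1 = 1.
Proof.
apply: val_inj; change (iota 1 = vsval (1 : C)).
by rewrite vsval_cent1 rmorph1.
Qed.

Lemma cent_elt0 : cent_elt 0 = 0.
Proof. by apply: val_inj; rewrite /= rmorph0. Qed.

Lemma cent_eltC a (c : C) : cent_elt a * c = c * cent_elt a.
Proof. by apply: val_inj => /=; have /cent_memP -> := valP c. Qed.

Lemma twist_cent_elt s a : twist u s (cent_elt a) = cent_elt (s a).
Proof. by apply: val_inj; rewrite /= (sn_conj u). Qed.

(** Conjugation by the unit at [t^-1] turns [iota (t l)] into [iota l], so dividing the component of
    type [t] on the left by that unit puts it in the centralizer. *)
Lemma cent_decomposition (a : A) :
  exists r : G -> C, a = \sum_s u s * vsval (r s).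
Proof.
have [n [x [y dual]]] := gal_dual_bases K.
have central (b : K) (r : A) : b \in 1%VS -> iota b * r = r * iota b.
  by move=> /vlineP[c ->]; rewrite rmorph_alg mulr_algl mulr_algr.
pose P t := isotypic_proj x y iota t a.
have sC t : (u (t^-1)%g)^-1 * P t \in 'C((iota @: fullv)%VS)%AS.
  apply/cent_memP => l; have Us := sn_unit u (t^-1)%g.
  have lE : iota l * (u (t^-1)%g)^-1 = (u (t^-1)%g)^-1 * iota (t l).
    rewrite -[l in LHS](gal_id {:K}) -(mulgV t) galM ?memvf // (sn_conj u).
    by rewrite mulrK.
  by rewrite -mulrA -(isotypic_projP galK dual central) !mulrA lE.
exists (fun s => Subvs (sC s^-1%g)).
rewrite {1}(isotypic_decomposition galK dual central a).
rewrite (reindex_inj (@invg_inj _)) /=; apply: eq_bigr => s _.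
by rewrite invgK mulVKr // sn_unit.
Qed.

Lemma dim_central_simple_le : (\dim {:A} <= #|fullG| * \dim {:C})%N.
Proof.
rewrite cardsT -dim_ffun.
apply: (@linear_surj_dim _ _ _ (fun r : {ffun G -> C} => \sum_s u s * vsval (r s))).
  move=> a r s; rewrite scaler_sumr -big_split; apply: eq_bigr => i _.
  by rewrite !ffunE linearP mulrDr -scalerAr.
move=> a; have [r ->] := cent_decomposition a; exists [ffun s => r s].
by apply: eq_bigr => s _; rewrite ffunE.
Qed.

(** The bound concerns central simple algebras, so the subfield is transported from the centralizer
    to [A]. *)
Lemma subfield_cent_bound (M : set C) (U : {vspace C}) : is_subfield M ->
  [set` U] = M -> (forall a : F, M a%:A) -> (\dim U ^ 2 <= \dim {:A})%N.
Proof.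
move=> subM UM Mk; have UE c : c \in U <-> M c.
  by rewrite -[X in X <-> _]/([set` U] c) UM.
pose X : set A := [set vsval c | c in M].
have subX : is_subfield X.
  have [M1 MB MM MC MV] := subM; split.
  - by exists 1 => //; exact: vsval_cent1.
  - by move=> _ _ [x Mx <-] [y My <-]; exists (x - y) => //; exact: MB.
  - by move=> _ _ [x Mx <-] [y My <-]; exists (x * y) => //; exact: MM.
  - by move=> _ _ [x Mx <-] [y My <-]; rewrite -!vsvalM MC.
  - move=> _ [x Mx <-]; rewrite vsval_eq0 => x0; have [y My xy] := MV x Mx x0.
    by exists (vsval y); [exists y | rewrite -vsvalM xy vsval_cent1].
have [a|V VX] := subfield_aspace subX.
  by exists a%:A; [exact: Mk | exact: vsval_scalar].
have VE a : a \in V <-> X a by rewrite -[X in X <-> _]/([set` V] a) VX.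
apply: leq_trans (commutative_division_bound csA (U := V) _ _).
- rewrite leq_exp2r // -dim_subvs.
  apply: (@linear_inj_dim _ _ _ (fun c : subvs_of U => vsval (vsval c))).
  + by move=> a c d; rewrite !linearP.
  + by move=> c; apply/VE; exists (vsval c) => //; exact/UE/subvsP.
  + by move=> c /eqP; rewrite vsval_eq0 => /eqP c0; apply: val_inj.
- by move=> x /VE Xx; exact: subfield_unit subX Xx.
- by move=> x y /VE Xx /VE Xy; case: subX => _ _ _ h _; exact: h.
Qed.

End Centralizer.

Section MaximalSubfield.
Variables (F : fieldType) (A : falgType F) (K : splittingFieldType F).
Variables (iota : 'AHom(K, A)) (u : skolem_noether iota).
Variables (Gamma : orderedAbelianType).
Variable eps : addmul_hom Gamma (gal_of {:K}%AS).
Hypotheses (csA : is_central_simple A) (galK : galois 1%AS {:K}%AS).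
Hypothesis eps_surj : forall s : gal_of {:K}%AS, exists g : Gamma, eps g = s.
Hypothesis divC : forall c : cent iota, c != 0 -> c \is a GRing.unit.

Local Notation C := (cent iota).
Local Notation D := (mn_ring u eps).
Local Notation G := (gal_of {:K}%AS).
Local Notation fullG := (finset.setTfor G).

Variable L : set D.
Hypothesis maxL : is_maximal_subfield L.

Let hL : is_subfield L := proj1 maxL.
Let centL := maximal_subfield_cent (mn_division divC) maxL.

Local Notation M := (compositum (residue L) (cent_field iota)).

Lemma residue_compositum_subfield : is_subfield M.
Proof.
have [_ _ _ commR _] := residue_subfield divC hL centL.
apply: compositum_subfield; first exact: cent_division.
move=> x y [Lx|/cent_fieldE[a ->]] [Ly|/cent_fieldE[b ->]].
- exact: commR.
- by rewrite cent_eltC.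
- by rewrite cent_eltC.
- by rewrite cent_eltC.
Qed.

Lemma residue_sub_compositum : residue L `<=` M.
Proof. by move=> x Lx; apply: sub_compositum; left. Qed.

Lemma cent_elt_compositum a : M (cent_elt iota a).
Proof. by apply: sub_compositum; right; apply/cent_fieldE; exists a. Qed.

(* Conjugation by u_s r, for x = a_g r + ... in L with eps g = s, is the
   identity on the residue field of L and s on K, so Artin's argument
   applies to the group of these automorphisms. *)
Lemma residue_compositum_dim (R V : {vspace C}) :
  [set` R] = residue L -> [set` V] = M ->
  (#|value_image L| * \dim R <= \dim V)%N.
Proof.
move=> RL VM; have RE c : c \in R <-> residue L c.
  by rewrite -[X in X <-> _]/([set` R] c) RL.
have VE c : c \in V <-> M c by rewrite -[X in X <-> _]/([set` V] c) VM.
have [w _ [uP _ _]] := gal_matrix (value_image L).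
set P := \matrix_(i, j) _ in uP.
rewrite -[#|_|]card_ord -[\dim R]dim_subvs -dim_ffun.
pose f (l : {ffun 'I_#|value_image L| -> subvs_of R}) : C :=
  \sum_j vsval (l j) * cent_elt iota (tnth w j).
have [_ _ MM _ _] := residue_compositum_subfield.
apply: (@linear_inj_dim _ _ _ f).
- move=> a l m; rewrite scaler_sumr -big_split; apply: eq_bigr => j _.
  by rewrite !ffunE linearP mulrDl -scalerAl.
- move=> l; apply: rpred_sum => j _; apply/VE.
  apply: (MM _ _ _ (cent_elt_compositum _)).
  by apply: residue_sub_compositum; apply/RE; apply: subvsP.
- move=> l fl0; pose s (i : 'I_#|value_image L|) : G := enum_val i.
  (* Twisting by [s i] and moving [r] across restores the coefficients from the residue field and
     applies [s i] to those from [K]. *)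
  have key i : \sum_j vsval (l j) * cent_elt iota (s i (tnth w j)) = 0.
    have [|r r0 rP] := @residue_conj _ _ _ _ _ _ _ L hL (s i).
      exact: enum_valP.
    apply: (cent_mul_eq0 divC _ r0).
    have /(congr1 (fun c => twist u (s i) c * r)) := fl0.
    rewrite twist0 mul0r => e; apply: etrans e.
    rewrite mulr_sumr /f (big_morph _ (twistD u (s i)) (twist0 u (s i))).
    rewrite mulr_suml.
    apply: eq_bigr => j _; rewrite twistM twist_cent_elt -mulrA cent_eltC !mulrA.
    by rewrite rP //; apply/RE; apply: subvsP.
  apply/ffunP => j0; rewrite ffunE; apply: val_inj; rewrite [RHS]/=.
  (* The inverse of the matrix [P] isolates [l j0]. *)
  transitivity (\sum_i (\sum_j vsval (l j) * cent_elt iota (s i (tnth w j)))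
    * cent_elt iota (invmx P j0 i)); last first.
    by apply: big1 => i _; rewrite key mul0r.
  under eq_bigr do rewrite mulr_suml; rewrite exchange_big /=.
  transitivity (\sum_j vsval (l j) * cent_elt iota (j0 == j)%:R).
    rewrite (bigD1 j0) //= eqxx cent_elt1 mulr1 big1 ?addr0 // => j jj0.
    by rewrite eq_sym (negPf jj0) cent_elt0 mulr0.
  apply: eq_bigr => j _; have /matrixP/(_ j0 j) := mulVmx uP.
  rewrite !mxE => <-; rewrite cent_elt_sum mulr_sumr; apply: eq_bigr => i _.
  by rewrite mxE mulrC cent_eltM mulrA.
Qed.

Lemma residue_compositum_maximal : is_maximal_subfield M.
Proof.
have subM := residue_compositum_subfield; split => // M' subM' MM'.
have subR := residue_subfield divC hL centL.
have Rk (a : F) : residue L a%:A := residue_scalar centL a.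
have Mk (a : F) : M a%:A := residue_sub_compositum (Rk a).
have [R RL] := subfield_aspace subR Rk.
have [V VM] := subfield_aspace subM Mk.
have [V' VM'] := subfield_aspace subM' (fun a => MM' _ (Mk a)).
have RE c : c \in R <-> residue L c by rewrite -[X in X <-> _]/([set` R] c) RL.
have [n [e [dimC _ indep]]] : exists n (e : 'I_n -> C),
    [/\ (n * \dim R)%N = \dim {:C},
      forall x, exists2 w, (forall j, w j \in R) & x = \sum_j w j * e j &
      forall w, (forall j, w j \in R) -> \sum_j w j * e j = 0 ->
        forall j, w j = 0].
  by apply: module_basis => x _; exact: divC.
have le1 := residue_bound divC eps_surj hL centL (c := e).
have {}le1 : ((#|fullG : value_image L|%g * n) ^ 2 <= #|fullG| * \dim {:C})%N.
  by apply: le1 => w Rw; apply: indep => j; exact/RE.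
have le2 := residue_compositum_dim RL VM.
have le3 := subfield_cent_bound csA subM' VM' (fun a => MM' _ (Mk a)).
have le4 := dim_central_simple_le u galK.
have cardG : (#|value_image L| * #|fullG : value_image L|%g)%N = #|fullG|.
  apply: (@Lagrange _ [set: G]%G (value_group divC hL)).
  by apply/fintype.subsetP => s; rewrite inE.
have VV' : (V <= V')%VS.
  apply/subvP => c Vc; have : [set` V'] c by rewrite VM'; apply: MM'; rewrite -VM.
  by [].
have : (\dim V' <= \dim V)%N.
  (* Let h and i be the order and index of [value_image L], l = [\dim R], a = i n and b = h l. Then
     [le1] reads a^2 <= a b, whence a b <= b^2, while [le3] and [le4] bound the square of [\dim V']
     by a b. *)
  apply: leq_trans le2; rewrite -(@leq_exp2r _ _ 2) //.
  apply: leq_trans (leq_trans le3 le4) _.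
  move: le1; rewrite -cardG -dimC.
  move: #|_| (#|_ : _|%g) (\dim R) => h i l.
  have -> : (h * i * (n * l) = (i * n) * (h * l))%N.
    by rewrite [(h * i)%N]mulnC mulnACA.
  move: (i * n)%N (h * l)%N => a b; rewrite -!mulnn.
  have [->|a0] := posnP a; first by rewrite mul0n.
  by rewrite leq_pmul2l // => ab; rewrite leq_mul2r ab orbT.
move: (dimv_leqif_eq VV') => /geq_leqif -> /eqP VV.
by rewrite -VM' -VM VV.
Qed.

End MaximalSubfield.

(** * The Galois case *)

Section SubfieldExtension.
Variables (k : fieldType) (B : falgType k) (U : {aspace B}).

(** A copy of [subvs_of U] whose phantom proof allows canonical field structures. *)
Definition subfield_ext of is_subfield [set` U] := subvs_of U.

Variable h : is_subfield [set` U].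

HB.instance Definition _ := Falgebra.copy (subfield_ext h) (subvs_of U).

Fact subfield_ext_mulC : @commutative (subfield_ext h) _ *%R.
Proof.
move=> x y; apply: val_inj => /=; have [_ _ _ hC _] := h.
by apply: hC; exact: subvsP.
Qed.
HB.instance Definition _ :=
  GRing.PzSemiRing_hasCommutativeMul.Build (subfield_ext h) subfield_ext_mulC.

Lemma subfield_ext_algid : algid U = 1.
Proof. by apply/eqP; rewrite algid_eq1; case: h. Qed.

Fact subfield_ext_field : GRing.field_axiom (subfield_ext h).
Proof.
move=> x x0; apply: (@vsval_unitr _ _ U).
apply: (subfield_unit h); first exact: subvsP.
by apply: contra x0 => /eqP x0; apply/eqP/val_inj.
Qed.
HB.instance Definition _ :=
  GRing.ComUnitRing_isField.Build (subfield_ext h) subfield_ext_field.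

Definition subfield_ext_val (x : subfield_ext h) : B := vsval x.

Fact subfield_ext_val_zmod : zmod_morphism subfield_ext_val.
Proof. by []. Qed.
Fact subfield_ext_val_monoid : monoid_morphism subfield_ext_val.
Proof. by split=> //; exact: subfield_ext_algid. Qed.
HB.instance Definition _ := GRing.isZmodMorphism.Build
  (subfield_ext h) B subfield_ext_val subfield_ext_val_zmod.
HB.instance Definition _ := GRing.isMonoidMorphism.Build
  (subfield_ext h) B subfield_ext_val subfield_ext_val_monoid.

Lemma subfield_ext_val_inj : injective subfield_ext_val.
Proof. exact: val_inj. Qed.

Lemma subfield_ext_val_scalar a : subfield_ext_val a%:A = a%:A.
Proof.
by rewrite /subfield_ext_val linearZ; congr (_ *: _); exact: subfield_ext_algid.
Qed.

Lemma subfield_ext_scalarP (x : subfield_ext h) :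
  x \in 1%VS <-> exists a : k, subfield_ext_val x = a%:A.
Proof.
split=> [/vlineP[a ->]|[a xa]]; first by exists a; exact: subfield_ext_val_scalar.
apply/vlineP; exists a; apply: subfield_ext_val_inj.
by rewrite xa subfield_ext_val_scalar.
Qed.

Lemma subfield_ext_ex b :
  b \in U -> exists x : subfield_ext h, subfield_ext_val x = b.
Proof. by move=> Ub; exists (vsproj U b); exact: vsprojK. Qed.

End SubfieldExtension.

(** * Splitting and separability of generators *)

Section SplittingElements.
Variables (k : fieldType) (N : fieldExtType k).

Definition splits_over_base (x : N) : Prop := exists rs : seq N,
  \prod_(r <- rs) ('X - r%:P) \is a polyOver 1%VS /\ x \in rs.

(** Concatenating root lists multiplies the polynomials, which yields one split polynomial over the
    base with all generators among its roots. *)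
Lemma splitting_generators (S : seq N) :
    (forall x, x \in S -> splits_over_base x) -> (<<1 & S>> = fullv)%VS ->
  SplittingField.axiom N.
Proof.
move=> splS genS; suff [rs [Prs Srs]] : exists rs : seq N,
    \prod_(r <- rs) ('X - r%:P) \is a polyOver 1%VS /\ {subset S <= rs}.
  exists (\prod_(r <- rs) ('X - r%:P)) => //; exists rs; first exact: eqpxx.
  by apply/eqP; rewrite eqEsubv subvf -genS; exact: adjoin_seqSr.
elim: S splS {genS} => [|x S IH] splS.
  by exists [::]; rewrite big_nil rpred1.
have [y Sy|rs [Prs Srs]] := IH; first by apply: splS; rewrite inE Sy orbT.
have [|rx [Px xrx]] := splS x; first exact: mem_head.
exists (rx ++ rs); rewrite big_cat rpredM //; split => // y.
by rewrite inE mem_cat => /predU1P[->|/Srs ->]; rewrite ?xrx ?orbT.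
Qed.

(** If the minimal polynomial had zero derivative, its degree would vanish in [k]; the
    characteristic would then divide this degree, hence [\dim W]. *)
Lemma separable_degree (W : {subfield N}) (x : N) : x \in W ->
  (forall p : nat, p \in [pchar k] -> ~~ (p %| \dim W)%N) ->
  separable_element 1 x.
Proof.
move=> Wx pW; rewrite separable_nz_der; apply/eqP => der0.
have sz := size_minPoly 1 x; set n := adjoin_degree 1 x in sz.
have n0 : (0 < n)%N by [].
have /(congr1 (fun p : {poly N} => p`_n.-1)) := der0.
rewrite coef_deriv coef0 prednK //.
have /monicP := monic_minPoly 1 x; rewrite /lead_coef sz /= => ->.
move/eqP => nN; have nk : n%:R == 0 :> k.
  by rewrite -(fmorph_eq0 (in_alg N)) rmorph_nat.
have [p pk] := natf0_pchar n0 nk.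
have pn : (p %| n)%N by rewrite (dvdn_pcharf pk).
have /negP[] := pW p pk; apply: dvdn_trans pn _.
rewrite /n adjoin_degreeE dimv1 divn1; apply: field_dimS.
by apply/FadjoinP; split => //; exact: sub1v.
Qed.

End SplittingElements.

(** * Reduction of minimal polynomials to the residue field *)

Section GaloisSubfield.
Variables (F : fieldType) (A : falgType F) (K : splittingFieldType F).
Variables (iota : 'AHom(K, A)) (u : skolem_noether iota).
Variables (Gamma : orderedAbelianType).
Variable eps : addmul_hom Gamma (gal_of {:K}%AS).
Hypotheses (csA : is_central_simple A) (galK : galois 1%AS {:K}%AS).
Hypothesis eps_surj : forall s : gal_of {:K}%AS, exists g : Gamma, eps g = s.
Hypothesis divC : forall c : cent iota, c != 0 -> c \is a GRing.unit.

Local Notation C := (cent iota).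
Local Notation D := (mn_ring u eps).
Local Notation G := (gal_of {:K}%AS).
Local Notation Z := (mn_sub (u := u) (scalars C) (addmul_ker eps)).
Implicit Types (x y : D) (g h : Gamma) (r c : C).

Lemma mn_coefM_monol g c x h : (mn_mono u eps g c * x) h =
  cocycle u (eps g) (eps (h - g)) * twist u (eps (h - g)) c * x (h - g).
Proof.
rewrite mn_coefM (@fsum_seq _ _ [set g]) //.
  by rewrite fset_set1 big_seq_fset1 /= eqxx.
by move=> k /eqP /negPf kg /=; rewrite kg twist0 mulr0 mul0r.
Qed.

(** Commuting with constants from [K] forces the support into the kernel. The coefficients then
    commute with the centralizer and, by comparison with the monomials [mn_mono u eps h 1], with
    every [u s]; these generate [A], whose center is [F]. *)
Lemma mn_center x : (forall y, x * y = y * x) -> Z x.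
Proof.
move=> cx; have coefC g c : x g * c = twist u (eps g) c * x g.
  have /(congr1 (fun z : D => z g)) := cx (mn_mono u eps 0 c).
  by rewrite mn_coefM_const mn_coefM_monol subr0 addmul_fun0 cocycle1g mul1r.
have kerx g : x g != 0 -> eps g = 1%g.
  move=> xg; apply/eqP/gal_eqP => a _; rewrite gal_id.
  have := coefC g (cent_elt iota a); rewrite twist_cent_elt -cent_eltC => e.
  have [y [_ xy]] := cent_division divC xg.
  have : cent_elt iota a = cent_elt iota (eps g a).
    by rewrite -[LHS]mulr1 -[RHS]mulr1 -xy !mulrA e.
  by move/(congr1 vsval) => /= /fmorph_inj /esym.
split=> [g /kerx //|g /= eg].
have xgC c : x g * c = c * x g by rewrite coefC eg twistid.
have twg s : twist u s (x g) = x g.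
  have [h hs] := eps_surj s.
  have /(congr1 (fun z : D => z (g + h))) := cx (mn_mono u eps h 1).
  rewrite mn_coefM_mono mn_coefM_monol !addrK.
  by rewrite eg hs cocycle1g cocycleg1 twistid !mul1r mulr1 => ->.
have uxg s : vsval (x g) * u s = u s * vsval (x g).
  by rewrite -[in RHS](twg s) /= !mulrA mulrV ?sn_unit // mul1r.
have [a|a xa] := central_scalar csA (a := vsval (x g)).
  have [r ->] := cent_decomposition u galK a.
  rewrite mulr_sumr mulr_suml; apply: eq_bigr => t _.
  by rewrite mulrA uxg -!mulrA -!vsvalM xgC.
by exists a => //; apply: vsval_inj; rewrite xa vsval_scalar.
Qed.

Variable L : set D.
Hypothesis maxL : is_maximal_subfield L.
Variables (k : fieldType) (E : splittingFieldType k) (f : {rmorphism E -> D}).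
Hypotheses (galE : galois 1%AS {:E}%AS) (fL : f @` [set` {:E}%AS] = L).
Hypothesis fZ : f @` [set` (1%AS : {aspace E})] = Z.

Lemma galois_image_scalar a : a \in 1%VS <-> Z (f a).
Proof.
rewrite -fZ; split=> [a1|[b b1 /fmorph_inj <-]] //; by exists a.
Qed.

(* The Skolem-Noether theorem for L in D: D is the sum of its isotypic
   components, and the t whose component is nonzero form a group with fixed
   field Z. *)
Lemma galois_inner (t : gal_of {:E}%AS) :
  exists2 d : D, d != 0 & forall l, f (t l) * d = d * f l.
Proof.
pose S : {set gal_of {:E}%AS} :=
  [set t : gal_of {:E}%AS |
    `[< exists2 d : D, d != 0 & forall l, f (t l) * d = d * f l >]]%SET.
have SP s : s \in S <-> exists2 d : D, d != 0 & forall l, f (s l) * d = d * f l.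
  by rewrite inE; split => /asboolP.
have mul0 := division_mul_neq0 (mn_division divC (u := u) (eps := eps)).
have groupS : group_set S.
  apply/group_setP; split.
    apply/SP; exists 1; first exact: oner_neq0.
    by move=> l; rewrite gal_id mulr1 mul1r.
  move=> s s' /SP[d d0 dP] /SP[d' d'0 dP']; apply/SP; exists (d' * d).
    exact: mul0.
  by move=> l; rewrite galM ?memvf // mulrA dP' -!mulrA dP.
have fix1 : (fixedField S <= 1)%VS.
  apply/subvP => l /fixedFieldP lS.
  have {}lS := lS (memvf l).
  apply/galois_image_scalar/mn_center => d.
  have [n [x [y dual]]] := gal_dual_bases E.
  have central (a : E) (r : D) : a \in 1%VS -> f a * r = r * f a.
    by move=> /galois_image_scalar; exact: Z_comm.
  rewrite (isotypic_decomposition galE dual central d) mulr_sumr mulr_suml.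
  apply: eq_bigr => s _; set p := isotypic_proj _ _ _ _ _.
  have pP l' : f (s l') * p = p * f l' by exact: isotypic_projP.
  (* A nonzero component has its type in [S], which fixes [l], so [f l] commutes with it. *)
  have [->|p0] := eqVneq p 0; first by rewrite mulr0 mul0r.
  by rewrite -pP lS //; apply/SP; exists p.
apply/SP; suff -> : S = finset.setTfor (gal_of {:E}%AS) by rewrite inE.
have <- : 'Gal({:E}%AS / fixedField S)%g = finset.setTfor (gal_of {:E}%AS).
  apply/setP => s; rewrite !inE (gal_kHom _ (fixedField_bound S)).
  apply/kHomP_tmp; split=> [a /(subvP fix1)|a b _ _]; last by rewrite rmorphM.
  exact: gal_scalar.
by rewrite (gal_fixedField (Group groupS)).
Qed.

Definition integral_elt (l : E) : Prop := forall h, h < 0 -> f l h = 0.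

(** In [f (t l) * d = d * f l] the value of [d] cancels, so [t] preserves the valuation. *)
Lemma galois_integral (t : gal_of {:E}%AS) l : integral_elt l -> integral_elt (t l).
Proof.
move=> l0; have [d d0 dP] := galois_inner t.
have [->|tl0] := eqVneq (t l) 0; first by move=> h _; rewrite rmorph0.
have ftl : f (t l) != 0 by rewrite fmorph_eq0.
have fl : f l != 0 by rewrite fmorph_eq0 -(fmorph_eq0 t).
have [g vt] := is_val_ex ftl; have [g' vl] := is_val_ex fl.
have [h vd] := is_val_ex d0.
have := is_valM divC vt vd; rewrite dP => /is_val_uniq/(_ (is_valM divC vd vl)).
rewrite addrC => /addrI gg'; move=> h' h'0; case: vt => _; apply.
apply: lt_le_trans h'0 _; rewrite gg' oleNgt; apply/negP => /l0 e.
by case: vl; rewrite e eqxx.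
Qed.

Local Notation M := (compositum (residue L) (cent_field iota)).
Variable V : {aspace C}.
Hypotheses (VM : [set` V] = M) (hV : is_subfield [set` V]).
Local Notation N := (subfield_ext hV).
Local Notation nval := (@subfield_ext_val F C V hV).

Lemma residue_lift (l : E) : integral_elt l -> exists z : N, nval z = f l 0.
Proof.
move=> l0; apply: subfield_ext_ex.
suff : [set` V] (f l 0) by [].
rewrite VM; apply: residue_sub_compositum.
apply/residueP; exists (f l); split => //; rewrite -fL.
by exists l => //; exact: memvf.
Qed.

(** On integral series the coefficient at 0 is additive and multiplicative, so the product can be
    reduced one factor at a time. *)
Lemma residue_poly (zs : seq E) : (forall z, z \in zs -> integral_elt z) ->
  exists rs : seq N,
    [/\ map nval rs = [seq f z 0 | z <- zs],
        forall i, integral_elt (\prod_(z <- zs) ('X - z%:P))`_i &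
        forall i, nval (\prod_(r <- rs) ('X - r%:P))`_i =
          f (\prod_(z <- zs) ('X - z%:P))`_i 0].
Proof.
elim: zs => [|z zs IH] zs0.
  exists [::]; rewrite !big_nil; split=> // i; rewrite coef1.
    move=> h h0; case: eqP => _; rewrite ?rmorph0 ?rmorph1 //.
    by rewrite mn_coef1 (lt_eqF h0).
  by rewrite coef1; case: eqP => _; rewrite ?rmorph0 ?rmorph1 // mn_coef1 eqxx.
have [w wz|rs [rsE int rP]] := IH; first by apply: zs0; rewrite inE wz orbT.
have z0 := zs0 z (mem_head _ _); have [r rz] := residue_lift z0.
exists (r :: rs); split; first by rewrite /= rz rsE.
- move=> i h h0; rewrite big_cons mulrBl coefB coefXM coefCM rmorphB rmorphM.
  rewrite mn_coefB (proj1 (mn_coefM0 z0 (int i))) // subr0.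
  by case: eqP => _; rewrite ?rmorph0 // int.
- move=> i; rewrite !big_cons !mulrBl !coefB !coefXM !coefCM !rmorphB !rmorphM.
  rewrite mn_coefB (proj2 (mn_coefM0 z0 (int i))) -rz -rP; congr (_ - _).
  by case: eqP => _; [rewrite !rmorph0 | exact: rP].
Qed.

(** A lift [l] has a minimal polynomial whose roots are Galois conjugates of [l], hence integral.
    Its coefficients lie in [Z], so their coefficients at 0 lie in [F]. *)
Lemma residue_splits (x : N) : residue L (nval x) -> splits_over_base x.
Proof.
move=> /residueP[d [Ld d0 dx]]; move: Ld; rewrite -fL => -[l _ fl].
have l0 : integral_elt l by rewrite /integral_elt fl.
have [r [_ _]] := elimT (galois_factors (sub1v {:E}%AS)) galE l (memvf l).
set zs := [seq _ | _ <- r] => minE.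
have zs0 z : z \in zs -> integral_elt z.
  by move=> /mapP[t _ ->]; exact: galois_integral.
have [rs [rsE int rP]] := residue_poly zs0.
exists rs; split.
  apply/polyOverP => i; apply/subfield_ext_scalarP; rewrite rP -minE.
  have /galois_image_scalar/(Z_coef 0) := polyOverP (minPolyOver 1 l) i.
  by case=> [[_ [a ->]]|->]; [exists a | exists 0; rewrite scale0r].
rewrite -(mem_map (@subfield_ext_val_inj _ _ _ hV)) rsE -dx -fl.
by apply: map_f; rewrite -root_prod_XsubC -minE root_minPoly.
Qed.

End GaloisSubfield.

(** * The copy of K inside the compositum *)

Section CentralizerExtension.
Variables (F : fieldType) (A : falgType F) (K : splittingFieldType F).
Variable iota : 'AHom(K, A).
Hypothesis galK : galois 1%AS {:K}%AS.
Local Notation C := (cent iota).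
Variables (V : {aspace C}) (hV : is_subfield [set` V]).
Hypothesis KV : forall a, cent_elt iota a \in V.
Local Notation N := (subfield_ext hV).
Local Notation nval := (@subfield_ext_val F C V hV).

Definition cent_ext (a : K) : N := vsproj V (cent_elt iota a).

Lemma cent_extE a : nval (cent_ext a) = cent_elt iota a.
Proof. exact: (vsprojK (KV a)). Qed.

Fact cent_ext_zmod : zmod_morphism cent_ext.
Proof.
move=> a b; apply: subfield_ext_val_inj; rewrite rmorphB /= !cent_extE.
by apply: vsval_inj; rewrite /= rmorphB.
Qed.
Fact cent_ext_monoid : monoid_morphism cent_ext.
Proof.
split=> [|a b]; apply: subfield_ext_val_inj.
  by rewrite rmorph1 cent_extE cent_elt1.
by rewrite rmorphM /= !cent_extE cent_eltM.
Qed.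
HB.instance Definition _ :=
  GRing.isZmodMorphism.Build K N cent_ext cent_ext_zmod.
HB.instance Definition _ :=
  GRing.isMonoidMorphism.Build K N cent_ext cent_ext_monoid.

Lemma cent_elt_scalar (a : F) : cent_elt iota a%:A = a%:A.
Proof.
apply: vsval_inj; rewrite vsval_scalar /= linearZ /=.
by congr (_ *: _); exact: rmorph1.
Qed.

Lemma cent_ext_scalar a : a \in 1%VS -> cent_ext a \in 1%VS.
Proof.
move=> /vlineP[c ->]; apply/subfield_ext_scalarP; exists c.
by rewrite cent_extE cent_elt_scalar.
Qed.

Lemma cent_ext_poly (p : {poly K}) : p \is a polyOver 1%VS ->
  map_poly cent_ext p \is a polyOver 1%VS.
Proof.
move=> /polyOverP p1; apply/polyOverP => i; rewrite coef_map.
exact/cent_ext_scalar/p1.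
Qed.

Lemma cent_ext_basis (W : {subfield N}) a :
  (forall b, b \in vbasis {:K} -> cent_ext b \in W) -> cent_ext a \in W.
Proof.
move=> bW; rewrite (coord_vbasis (memvf a)) rmorph_sum; apply: rpred_sum => i _.
rewrite -mulr_algl rmorphM; apply: memvM.
  apply: subvP (cent_ext_scalar _); first exact: sub1v.
  by rewrite rpredZ // mem1v.
by apply: bW; rewrite mem_nth // size_tuple.
Qed.

Lemma cent_ext_splits a : splits_over_base (cent_ext a).
Proof.
have [r [_ _ minE]] := elimT (galois_factors (sub1v {:K}%AS)) galK a (memvf a).
exists (map cent_ext [seq x a | x : gal_of {:K}%AS <- r]); split.
  have -> :
      \prod_(b <- map cent_ext [seq x a | x : gal_of {:K}%AS <- r]) ('X - b%:P)
      = map_poly cent_ext (minPoly 1 a).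
    rewrite minE rmorph_prod [LHS]big_map; apply: eq_bigr => b _.
    by rewrite rmorphB /= map_polyX map_polyC.
  exact/cent_ext_poly/minPolyOver.
by apply: map_f; rewrite -root_prod_XsubC -minE root_minPoly.
Qed.

Lemma cent_ext_separable a : separable_element 1 (cent_ext a).
Proof.
apply/separable_elementP; exists (map_poly cent_ext (minPoly 1 a)); split.
- exact/cent_ext_poly/minPolyOver.
- by rewrite fmorph_root root_minPoly.
- rewrite separable_map; have /and3P[_ /separableP sepK _] := galK.
  exact/sepK/memvf.
Qed.

End CentralizerExtension.

Section SubfieldMorphism.
Variables (N : fieldType) (R : nzRingType) (f : {rmorphism N -> R}).

Lemma subfield_preimage (X : set R) : is_subfield X -> is_subfield (f @^-1` X).
Proof.
move=> [X1 XB XM _ XV]; split=> [|x y|x y|x y _ _|x Xx x0].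
- by rewrite /preimage /= rmorph1.
- by rewrite /preimage /= rmorphB; exact: XB.
- by rewrite /preimage /= rmorphM; exact: XM.
- exact: mulrC.
- have [|y Xy xy] := XV _ Xx; first by rewrite fmorph_eq0.
  exists x^-1; last exact: mulfV.
  suff e : y = f x^-1 by rewrite /preimage /= -e.
  by rewrite -[y]mul1r -(rmorph1 f) -(mulVf x0) rmorphM -mulrA xy mulr1.
Qed.

Lemma subfield_image (X : set N) : is_subfield X -> is_subfield (f @` X).
Proof.
move=> [X1 XB XM _ XV]; split.
- by exists 1; rewrite ?rmorph1.
- by move=> _ _ [x Xx <-] [y Xy <-]; exists (x - y); [exact: XB | rewrite rmorphB].
- by move=> _ _ [x Xx <-] [y Xy <-]; exists (x * y); [exact: XM | rewrite rmorphM].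
- by move=> _ _ [x Xx <-] [y Xy <-]; rewrite -!rmorphM mulrC.
- move=> _ [x Xx <-]; rewrite fmorph_eq0 => x0; have [y Xy xy] := XV x Xx x0.
  by exists (f y); [exists y | rewrite -rmorphM xy rmorph1].
Qed.

End SubfieldMorphism.

Lemma aspace_subfield (k : fieldType) (N : fieldExtType k) (W : {subfield N}) :
  is_subfield [set` W].
Proof.
split=> /= [|x y|x y|x y _ _|x Wx x0].
- exact: mem1v.
- exact: rpredB.
- exact: memvM.
- exact: mulrC.
- by exists x^-1; [rewrite /= memvV | exact: mulfV].
Qed.

(** * The compositum as a Galois extension *)

Section GaloisCompositum.
Variables (F : fieldType) (A : falgType F) (K : splittingFieldType F).
Variables (iota : 'AHom(K, A)) (u : skolem_noether iota).
Variables (Gamma : orderedAbelianType).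
Variable eps : addmul_hom Gamma (gal_of {:K}%AS).
Hypotheses (csA : is_central_simple A) (galK : galois 1%AS {:K}%AS).
Hypothesis eps_surj : forall s : gal_of {:K}%AS, exists g : Gamma, eps g = s.
Hypothesis divC : forall c : cent iota, c != 0 -> c \is a GRing.unit.

Local Notation C := (cent iota).
Local Notation D := (mn_ring u eps).
Variable L : set D.
Hypothesis maxL : is_maximal_subfield L.
Local Notation M := (compositum (residue L) (cent_field iota)).

(** The compositum is generated by bases of the residue field and of [K], so splitting and
    separability are checked on these; the degree hypothesis gives separability on the first
    part. *)
Lemma residue_compositum_galois :
    is_galois_extension (mn_sub (scalars C) (addmul_ker eps)) L ->
    (forall p : nat, p \in [pchar F] -> ~~ (p %| set_dim (residue L))%N) ->
  is_galois_extension (scalars C) M.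
Proof.
move=> [k [E [f [galE fL fZ]]]] pR.
have hL := proj1 maxL.
have centL := maximal_subfield_cent (mn_division divC) maxL.
have subM := residue_compositum_subfield divC maxL.
have subR := residue_subfield divC hL centL.
have RM : residue L `<=` M := @residue_sub_compositum _ _ _ _ _ _ _ L.
have Rk (a : F) : residue L a%:A := residue_scalar centL a.
have [R RL] := subfield_aspace subR Rk.
have [V VM] := subfield_aspace subM (fun a => RM _ (Rk a)).
have hV : is_subfield [set` V] by rewrite VM.
have RE c : c \in R <-> residue L c by rewrite -[X in X <-> _]/([set` R] c) RL.
have VE c : c \in V <-> M c by rewrite -[X in X <-> _]/([set` V] c) VM.
have KV a : cent_elt iota a \in V by apply/VE; exact: cent_elt_compositum.
pose N : fieldExtType F := subfield_ext hV.
pose nval : {rmorphism N -> C} := @subfield_ext_val F C V hV.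
have nval_inj : injective nval by exact: subfield_ext_val_inj.
have [RN RNE] : exists RN : {aspace N}, [set` RN] = nval @^-1` residue L.
  apply: subfield_aspace => [|a]; first exact: subfield_preimage.
  by have := Rk a; rewrite -(subfield_ext_val_scalar hV).
have RNP x : x \in RN <-> residue L (nval x).
  by rewrite -[X in X <-> _]/([set` RN] x) RNE.
(* This carries the hypothesis on [set_dim] over to the copy of the residue field inside [N]. *)
have dimRN : \dim RN = set_dim (residue L).
  rewrite -RL set_dimE; apply/eqP; rewrite eqn_leq -(dim_subvs RN) -(dim_subvs R).
  apply/andP; split; rewrite [X in (_ <= X)%N]dim_subvs.
    apply: (@linear_inj_dim _ _ _ (fun x : subvs_of RN => nval (vsval x))) => //.
      by move=> x; apply/RE/RNP; exact: subvsP.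
    by move=> x /eqP; rewrite fmorph_eq0 => /eqP x0; apply: val_inj.
  apply: (@linear_inj_dim _ _ _ (fun x : subvs_of R => vsproj V (vsval x) : N)).
  - by move=> a x y; rewrite !linearP.
  - move=> x; apply/RNP.
    have Rx : residue L (vsval x) by apply/RE; exact: subvsP.
    suff -> : nval (vsproj V (vsval x)) = vsval x by [].
    by apply: vsprojK; apply/VE; exact: RM.
  - move=> x x0; apply: val_inj => /=.
    have Vx : vsval x \in V by apply/VE; apply: RM; apply/RE; exact: subvsP.
    by rewrite -(vsprojK Vx) x0.
pose cK := cent_ext hV.
pose S : seq N := vbasis RN ++ [seq cK b | b <- vbasis {:K}].
have genS : (<<1 & S>> = fullv)%VS.
  pose W := <<1 & S>>%AS.
  have RW x : x \in RN -> x \in W.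
    move=> RNx; apply: subvP x RNx; rewrite -(span_basis (vbasisP RN)).
    by apply/span_subvP => b Sb; apply: seqv_sub_adjoin; rewrite mem_cat Sb.
  have KW a : cK a \in W.
    apply: (cent_ext_basis KV) => b Kb; apply: seqv_sub_adjoin.
    by rewrite mem_cat map_f ?orbT.
  (* The image of the subfield generated by [S] is a subfield containing both parts, so it contains
     their compositum. *)
  pose X : set C := [set nval x | x in [set` W]].
  have subX : is_subfield X by apply: subfield_image; exact: aspace_subfield.
  have genX : residue L `|` cent_field iota `<=` X.
    move=> c [Rc|/cent_fieldE[a ->]]; last first.
      by exists (cK a); [exact: KW | exact: cent_extE].
    have [x xc] : exists x : N, nval x = c.
      by apply: subfield_ext_ex; apply/VE; exact: RM.
    by exists x => //; apply: RW; apply/RNP; rewrite xc.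
  apply/eqP; rewrite eqEsubv subvf; apply/subvP => x _.
  have Mx : M (nval x) by apply/VE; exact: subvsP.
  by have [y Wy /nval_inj <-] := Mx X (conj subX genX).
have splN : SplittingField.axiom N.
  apply: (splitting_generators (S := S)) genS => x.
  rewrite mem_cat => /orP[/vbasis_mem/RNP Rx|/mapP[b _ ->]].
    exact: (residue_splits csA galK eps_surj divC galE fL fZ VM).
  exact: cent_ext_splits.
have sepN : separable 1 {:N}.
  rewrite -genS; apply: separable_Fadjoin_seq; apply/allP => x.
  rewrite mem_cat => /orP[/vbasis_mem Rx|/mapP[b _ ->]].
    by apply: (separable_degree Rx) => p; rewrite dimRN; exact: pR.
  exact: cent_ext_separable.
pose E' : splittingFieldType F :=
  HB.pack N (FieldExt_isSplittingField.Build F N splN).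
exists F, E', nval; split.
- by apply/and3P; split; [exact: sub1v | exact: sepN | exact: normalFieldf].
- apply/seteqP; split=> [_ [x _ <-]|c Mc]; first by apply/VE; exact: subvsP.
  have [x xc] : exists x : N, nval x = c by apply: subfield_ext_ex; apply/VE.
  by exists x => //; exact: memvf.
- apply/seteqP; split=> [_ [x x1 <-]|_ [a _ <-]].
    have [a xa] := proj1 (subfield_ext_scalarP _) x1.
    by exists a => //; rewrite -xa.
  exists (a%:A : N); last exact: subfield_ext_val_scalar.
  by apply/subfield_ext_scalarP; exists a; exact: subfield_ext_val_scalar.
Qed.

End GaloisCompositum.

Theorem proposition1p4
    (F : fieldType) (A : falgType F) (K : splittingFieldType F)
    (iota : 'AHom(K, A)) (u : skolem_noether iota)
    (Gamma : orderedAbelianType)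
    (eps : addmul_hom Gamma (gal_of {:K}%AS)) :
  is_central_simple A ->
  galois 1%AS {:K}%AS ->
  abelian 'Gal({:K}%AS / 1%AS)%g ->
  (forall s : gal_of {:K}%AS, exists g : Gamma, eps g = s) ->
  (forall c : cent iota, c != 0 -> c \is a GRing.unit) ->
  forall L : set (mn_ring u eps), is_maximal_subfield L ->
    is_maximal_subfield (compositum (residue L) (cent_field iota)) /\
    (is_galois_extension
        (mn_sub (scalars (cent iota)) (addmul_ker eps)) L ->
     (forall p : nat, p \in [pchar F] ->
        ~~ (p %| set_dim (residue L))%N) ->
     is_galois_extension (scalars (cent iota))
        (compositum (residue L) (cent_field iota))).
Proof.
move=> csA galK _ eps_surj divC L maxL; split.
  exact: residue_compositum_maximal.
exact: residue_compositum_galois.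
Qed.
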